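(* Let $k\in\{0,1,2,\dots\}\cup\{\infty\}$. Then each of the classes $U_2(\mathbb{R},k)$, $U_3(\mathbb{R},k)$, $U_4(\mathbb{R},k)$, $U_5(\mathbb{R},k)$ is a dense $G_\delta$ subset of $C^k(\mathbb{R})$.
   Context: $C^k(\mathbb{R})$ is the space of $k$ times continuously differentiable $u:\mathbb{R}\to\mathbb{C}$, a Fréchet space with seminorms $\sup_{x\in[-n,n]}|u^{(l)}(x)|$, $n=1,2,\dots$, integers $0\le l\le k$. $D(z_0,r)$ is the open disk of center $z_0$, radius $r$. For $z_0\in\mathbb{R}$, $r>0$ let $\Omega(z_0,r)=D(z_0,r)\cap\{\operatorname{Im}z>0\}$, $P(z_0,r)=D(z_0,r)\cap\{\operatorname{Im}z<0\}$. $U_2(\mathbb{R},k)$: the $u\in C^k(\mathbb{R})$ for which there exist no $z_0\in\mathbb{R}$, $r>0$ and continuous $\lambda:\mathbb{R}\cup\Omega(z_0,r)\to\mathbb{C}$ holomorphic on $\Omega(z_0,r)$ with $\lambda=u$ on $D(z_0,r)\cap\mathbb{R}$. $U_3(\mathbb{R},k)$: the same with $P(z_0,r)$ instead of $\Omega(z_0,r)$. $U_4(\mathbb{R},k)=U_2(\mathbb{R},k)\cap U_3(\mathbb{R},k)$. $U_5(\mathbb{R},k)$: the $u\in C^k(\mathbb{R})$ for which there exist no $z_0\in\mathbb{R}$, $r>0$ and holomorphic $F:D(z_0,r)\to\mathbb{C}$ with $F=u$ on $D(z_0,r)\cap\mathbb{R}$. *)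

(* Defs.v *)
From Stdlib Require Import Reals.
Open Scope R_scope.

Definition C : Type := (R * R)%type.
Definition Cre (z : C) : R := fst z.
Definition Cim (z : C) : R := snd z.
Definition RtoC (x : R) : C := (x, 0).
Definition Cadd (z w : C) : C := (fst z + fst w, snd z + snd w).
Definition Csub (z w : C) : C := (fst z - fst w, snd z - snd w).
Definition Cmul (z w : C) : C :=
  (fst z * fst w - snd z * snd w, fst z * snd w + snd z * fst w).
Definition Cnorm (z : C) : R := sqrt (fst z * fst z + snd z * snd z).

Definition Disk (z0 : C) (r : R) (z : C) : Prop := Cnorm (Csub z z0) < r.
Definition Omega (z0 r : R) (z : C) : Prop := Disk (RtoC z0) r z /\ Cim z > 0.
Definition Pdisk (z0 r : R) (z : C) : Prop := Disk (RtoC z0) r z /\ Cim z < 0.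

Definition Cdiff_at (F : C -> C) (z : C) : Prop :=
  exists L : C, forall eps : R, eps > 0 -> exists delta : R, delta > 0 /\
    forall h : C, 0 < Cnorm h < delta ->
      Cnorm (Csub (Csub (F (Cadd z h)) (F z)) (Cmul L h)) <= eps * Cnorm h.

Definition holomorphic_on (U : C -> Prop) (F : C -> C) : Prop :=
  forall z, U z -> Cdiff_at F z.

Definition continuous_on (S : C -> Prop) (F : C -> C) : Prop :=
  forall z, S z -> forall eps : R, eps > 0 -> exists delta : R, delta > 0 /\
    forall w, S w -> Cnorm (Csub w z) < delta -> Cnorm (Csub (F w) (F z)) < eps.

Definition real_axis (z : C) : Prop := Cim z = 0.

Inductive natinf : Type := Fin (n : nat) | Inf.

Definition le_k (l : nat) (k : natinf) : Prop :=
  match k with Fin m => (l <= m)%nat | Inf => True end.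

(** d is a sequence of successive derivatives of u up to order k,
    each continuous (d l for l > k is irrelevant) *)
Definition is_Ck_seq (k : natinf) (u : R -> C) (d : nat -> R -> C) : Prop :=
  d 0%nat = u /\
  (forall l : nat, le_k (S l) k -> forall x : R,
      derivable_pt_lim (fun t => fst (d l t)) x (fst (d (S l) x)) /\
      derivable_pt_lim (fun t => snd (d l t)) x (snd (d (S l) x))) /\
  (forall l : nat, le_k l k ->
      continuity (fun t => fst (d l t)) /\ continuity (fun t => snd (d l t))).

Definition Ck (k : natinf) (u : R -> C) : Prop := exists d, is_Ck_seq k u d.

(** basic neighbourhoods of the Frechet topology (seminorms
    sup_{[-n,n]} |u^(l)|, 0 <= l <= k): v is (N,eps)-close to u *)
Definition close (k : natinf) (N : nat) (eps : R) (du dv : nat -> R -> C) : Prop :=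
  forall (l : nat) (x : R), (l <= N)%nat -> le_k l k -> Rabs x <= INR N ->
    Cnorm (Csub (dv l x) (du l x)) < eps.

Definition IsOpen (k : natinf) (O : (R -> C) -> Prop) : Prop :=
  forall u du, is_Ck_seq k u du -> O u ->
    exists (N : nat) (eps : R), eps > 0 /\
      forall v dv, is_Ck_seq k v dv -> close k N eps du dv -> O v.

Definition Dense (k : natinf) (A : (R -> C) -> Prop) : Prop :=
  forall u du, is_Ck_seq k u du -> forall (N : nat) (eps : R), eps > 0 ->
    exists v dv, is_Ck_seq k v dv /\ A v /\ close k N eps du dv.

Definition Gdelta (k : natinf) (A : (R -> C) -> Prop) : Prop :=
  exists O : nat -> (R -> C) -> Prop, (forall n, IsOpen k (O n)) /\
    forall u, Ck k u -> (A u <-> forall n, O n u).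

Definition U2 (k : natinf) (u : R -> C) : Prop :=
  Ck k u /\ ~ exists (z0 r : R) (lam : C -> C), r > 0 /\
    continuous_on (fun z => real_axis z \/ Omega z0 r z) lam /\
    holomorphic_on (Omega z0 r) lam /\
    (forall x : R, Rabs (x - z0) < r -> lam (RtoC x) = u x).

Definition U3 (k : natinf) (u : R -> C) : Prop :=
  Ck k u /\ ~ exists (z0 r : R) (lam : C -> C), r > 0 /\
    continuous_on (fun z => real_axis z \/ Pdisk z0 r z) lam /\
    holomorphic_on (Pdisk z0 r) lam /\
    (forall x : R, Rabs (x - z0) < r -> lam (RtoC x) = u x).

Definition U4 (k : natinf) (u : R -> C) : Prop := U2 k u /\ U3 k u.

Definition U5 (k : natinf) (u : R -> C) : Prop :=
  Ck k u /\ ~ exists (z0 r : R) (F : C -> C), r > 0 /\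
    holomorphic_on (Disk (RtoC z0) r) F /\
    (forall x : R, Rabs (x - z0) < r -> F (RtoC x) = u x).

(* Main.v *)
(** Locally extendable functions form a countable union of closed sets: for a fixed box over an
    interval and a bound [M], take the [u] that are uniform limits on the interval of boundary values of
    functions holomorphic in the box and bounded by [M]. By the two-constants theorem such
    approximants converge uniformly near the center of the interval, so [u] extends there.

    Density: the lacunary series [W x = sum exp(- n^2) cos(2^n x)] is smooth and extends to neither
    side of any interval. Indeed, after subtracting a trigonometric polynomial [W] has period
    [2 pi / 2^m], uniqueness makes the extension periodic as well, and shifting the contour
    forces Fourier coefficients smaller than [exp(- n^2)]. For given [u], an interval and a side,
    [u + t W] extends for at most one [t], so some arbitrarily small [t] avoids the countably many
    exceptions.

    The complex analysis rests on Goursat's lemma for rectangles; the Cauchy formula is used with the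
    constant [kappa z], the integral of [1 / (w - z)], of which only [kappa z <> 0] matters, and
    the maximum principle follows by applying it to powers. *)

Require Import Defs.
From Stdlib Require Import Reals Lra Lia Psatz ClassicalEpsilon FunctionalExtensionality Cantor.
From Coquelicot Require Import Coquelicot.

Open Scope R_scope.

(** * Complex differentiability in Caratheodory's form *)

(** That the [u] with an extension bounded by [M] form a closed set is usually read off from normal
    families. Here approximability itself is the condition: its failure is visible at a single error
    [e], so the complement is open without any compactness. The price is a passage from radius [r]
    to [r / 16], harmless because extensions on all intervals are excluded. Density of the
    intersection of two classes would normally call for Baire's theorem. Since the lacunary function
    is real-valued, conjugation turns lower extensions into upper ones without changing it, and a
    single parameter [t] can be chosen to serve both sides. The boundary values on the axis are
    merely continuous, so Goursat's lemma is needed with holomorphy in the open box only. Functions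
    are total and continuous on the whole plane, which frees integrals from domain conditions;
    extensions given on smaller sets are brought into this form by projecting the plane onto a
    closed box. *)

Definition cont (f : C -> C) (z : C) : Prop :=
  forall eps, 0 < eps -> exists d, 0 < d /\
    forall w, Cmod (w - z) < d -> Cmod (f w - f z) < eps.

(** [phi] is the difference quotient, completed by the derivative at [z]. The chain rule then needs
    no case distinction, and Cauchy's formula can integrate [phi] itself. *)
Definition cdiff (f : C -> C) (z : C) : Prop :=
  exists phi, cont phi z /\ forall w, f w = (f z + phi w * (w - z))%C.

Lemma Cmod_triangle_minus (x y z : C) : Cmod (x - z) <= Cmod (x - y) + Cmod (y - z).
Proof.
  replace (x - z)%C with ((x - y) + (y - z))%C by ring. apply Cmod_triangle.
Qed.

Lemma Cmod_sym (x y : C) : Cmod (x - y) = Cmod (y - x).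
Proof. replace (x - y)%C with (- (y - x))%C by ring. apply Cmod_opp. Qed.

Lemma Cmod_diag (x : C) : Cmod (x - x) = 0.
Proof. replace (x - x)%C with (RtoC 0) by ring. apply Cmod_0. Qed.

Lemma Cmod_le_sum (z : C) : Cmod z <= Rabs (fst z) + Rabs (snd z).
Proof.
  unfold Cmod. apply Rsqr_incr_0_var.
  - rewrite Rsqr_sqrt by nra. unfold Rsqr.
    pose proof (Rabs_pos (fst z)). pose proof (Rabs_pos (snd z)).
    rewrite <- (pow2_abs (fst z)), <- (pow2_abs (snd z)). nra.
  - pose proof (Rabs_pos (fst z)). pose proof (Rabs_pos (snd z)). lra.
Qed.

Lemma fst_le_Cmod (z : C) : Rabs (fst z) <= Cmod z.
Proof. eapply Rle_trans; [apply Rmax_l | apply Rmax_Cmod]. Qed.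

Lemma snd_le_Cmod (z : C) : Rabs (snd z) <= Cmod z.
Proof. eapply Rle_trans; [apply Rmax_r | apply Rmax_Cmod]. Qed.

Lemma cont_const (k z : C) : cont (fun _ => k) z.
Proof.
  intros e He. exists 1. split; [lra | intros w _]. now rewrite Cmod_diag.
Qed.

Lemma cont_id (z : C) : cont (fun w => w) z.
Proof. intros e He. now exists e. Qed.

Lemma cont_plus (f g : C -> C) (z : C) :
  cont f z -> cont g z -> cont (fun w => f w + g w)%C z.
Proof.
  intros Hf Hg e He.
  destruct (Hf (e/2)) as [d1 [Hd1 H1]]; [lra|].
  destruct (Hg (e/2)) as [d2 [Hd2 H2]]; [lra|].
  exists (Rmin d1 d2). split; [now apply Rmin_glb_lt|]. intros w Hw.
  replace (f w + g w - (f z + g z))%C with ((f w - f z) + (g w - g z))%C by ring.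
  eapply Rle_lt_trans; [apply Cmod_triangle|].
  specialize (H1 w (Rlt_le_trans _ _ _ Hw (Rmin_l _ _))).
  specialize (H2 w (Rlt_le_trans _ _ _ Hw (Rmin_r _ _))). lra.
Qed.

Lemma cont_mult (f g : C -> C) (z : C) :
  cont f z -> cont g z -> cont (fun w => f w * g w)%C z.
Proof.
  intros Hf Hg e He.
  pose proof (Cmod_ge_0 (f z)) as Pf. pose proof (Cmod_ge_0 (g z)) as Pg.
  set (A := Cmod (f z) + Cmod (g z) + 1).
  assert (HA : 0 < A) by (unfold A; lra).
  assert (Hm : 0 < Rmin 1 (e / A)) by (apply Rmin_glb_lt; [lra | now apply Rdiv_lt_0_compat]).
  destruct (Hf _ Hm) as [d1 [Hd1 H1]].
  destruct (Hg _ Hm) as [d2 [Hd2 H2]].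
  exists (Rmin d1 d2). split; [now apply Rmin_glb_lt|]. intros w Hw.
  specialize (H1 w (Rlt_le_trans _ _ _ Hw (Rmin_l _ _))).
  specialize (H2 w (Rlt_le_trans _ _ _ Hw (Rmin_r _ _))).
  replace (f w * g w - f z * g z)%C
    with ((f w - f z) * (g w - g z) + ((f w - f z) * g z + f z * (g w - g z)))%C by ring.
  eapply Rle_lt_trans; [apply Cmod_triangle|].
  eapply Rle_lt_trans; [apply Rplus_le_compat_l, Cmod_triangle|].
  rewrite !Cmod_mult.
  pose proof (Rmin_l 1 (e / A)). pose proof (Rmin_r 1 (e / A)).
  set (m := Rmin 1 (e/A)) in *.
  pose proof (Cmod_ge_0 (f w - f z)). pose proof (Cmod_ge_0 (g w - g z)).
  assert (m * A <= e).
  { apply Rle_trans with (e / A * A); [apply Rmult_le_compat_r; lra|]. right. field. lra. }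
  assert (Cmod (f w - f z) * Cmod (g w - g z) < m) by nra.
  assert (Cmod (f w - f z) * Cmod (g z) <= m * Cmod (g z)) by nra.
  assert (Cmod (f z) * Cmod (g w - g z) <= m * Cmod (f z)) by nra.
  unfold A in *. nra.
Qed.

Lemma cont_minus (f g : C -> C) (z : C) :
  cont f z -> cont g z -> cont (fun w => f w - g w)%C z.
Proof.
  intros Hf Hg. apply cont_plus; [assumption|].
  intros e He. destruct (Hg e He) as [d [Hd H]]. exists d. split; [assumption|].
  intros w Hw. replace (- g w - - g z)%C with (- (g w - g z))%C by ring.
  rewrite Cmod_opp. auto.
Qed.

Lemma cont_comp (g f : C -> C) (z : C) :
  cont f z -> cont g (f z) -> cont (fun w => g (f w)) z.
Proof.
  intros Hf Hg e He. destruct (Hg e He) as [d [Hd H]].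
  destruct (Hf d Hd) as [d' [Hd' H']]. exists d'. auto.
Qed.

Lemma cont_conj (z : C) : cont Cconj z.
Proof.
  intros e He. exists e. split; [assumption|]. intros w Hw.
  now rewrite <- Cminus_conj, Cmod_conj.
Qed.

Lemma cont_inv (z : C) : z <> RtoC 0 -> cont Cinv z.
Proof.
  intros Hz e He. pose proof (proj1 (Cmod_gt_0 z) Hz) as Pz.
  set (m := Cmod z) in *.
  exists (Rmin (m/2) (e * m * m / 2)).
  split. { apply Rmin_glb_lt; [lra|]. assert (0 < e*m*m); [|lra]. repeat apply Rmult_lt_0_compat; assumption. }
  intros w Hw.
  pose proof (Rlt_le_trans _ _ _ Hw (Rmin_l _ _)) as H1.
  pose proof (Rlt_le_trans _ _ _ Hw (Rmin_r _ _)) as H2.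
  assert (Hwm : m/2 < Cmod w).
  { pose proof (Cmod_triangle (z - w) w) as T. replace (z - w + w)%C with z in T by ring.
    rewrite Cmod_sym in T. fold m in T. lra. }
  assert (w <> RtoC 0) by (apply Cmod_gt_0; lra).
  replace (/ w - / z)%C with ((z - w) / (w * z))%C by (field; split; assumption).
  rewrite Cmod_div by (apply Cmult_neq_0; assumption). rewrite Cmod_mult, Cmod_sym. fold m.
  apply Rmult_lt_reg_r with (Cmod w * m); [apply Rmult_lt_0_compat; lra|].
  unfold Rdiv. rewrite Rmult_assoc, Rinv_l by (apply Rgt_not_eq, Rmult_lt_0_compat; lra).
  assert (e * (m/2*m) < e * (Cmod w * m)).
  { apply Rmult_lt_compat_l; [assumption|]. apply Rmult_lt_compat_r; lra. }
  lra.
Qed.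

Lemma cont_pow (f : C -> C) (n : nat) (z : C) : cont f z -> cont (fun w => f w ^ n)%C z.
Proof.
  intros Hf. induction n as [|n IH]; simpl; [apply cont_const | now apply cont_mult].
Qed.

Lemma cont_local (f g : C -> C) (z : C) (r : R) :
  0 < r -> (forall w, Cmod (w - z) < r -> f w = g w) -> cont f z -> cont g z.
Proof.
  intros Hr E Hf e He. destruct (Hf e He) as [d [Hd H]].
  exists (Rmin r d). split; [now apply Rmin_glb_lt|]. intros w Hw.
  rewrite <- !E.
  - apply H. eapply Rlt_le_trans; [exact Hw | apply Rmin_r].
  - now rewrite Cmod_diag.
  - eapply Rlt_le_trans; [exact Hw | apply Rmin_l].
Qed.

Lemma cdiff_cont (f : C -> C) (z : C) : cdiff f z -> cont f z.
Proof.
  intros [phi [Hphi E]].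
  assert (K : cont (fun w => f z + phi w * (w - z))%C z).
  { apply cont_plus; [apply cont_const|]. apply cont_mult; [assumption|].
    apply cont_minus; [apply cont_id | apply cont_const]. }
  apply (cont_local _ _ _ 1) with (3 := K); [lra|]. intros w _. now rewrite <- E.
Qed.

Lemma cdiff_const (k z : C) : cdiff (fun _ => k) z.
Proof. exists (fun _ => RtoC 0). split; [apply cont_const | intros w; ring]. Qed.

Lemma cdiff_id (z : C) : cdiff (fun w => w) z.
Proof. exists (fun _ => RtoC 1). split; [apply cont_const | intros w; ring]. Qed.

Lemma cdiff_plus (f g : C -> C) (z : C) :
  cdiff f z -> cdiff g z -> cdiff (fun w => f w + g w)%C z.
Proof.
  intros [p [Hp Ep]] [q [Hq Eq]]. exists (fun w => p w + q w)%C.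
  split; [now apply cont_plus|]. intros w. rewrite (Ep w), (Eq w). ring.
Qed.

Lemma cdiff_mult (f g : C -> C) (z : C) :
  cdiff f z -> cdiff g z -> cdiff (fun w => f w * g w)%C z.
Proof.
  intros Hf Hg. pose proof (cdiff_cont _ _ Hg) as Cg.
  destruct Hf as [p [Hp Ep]], Hg as [q [Hq Eq]].
  exists (fun w => p w * g w + f z * q w)%C. split.
  - apply cont_plus; apply cont_mult; try assumption. apply cont_const.
  - intros w. rewrite (Ep w), (Eq w). ring.
Qed.

Lemma cdiff_scal (k : C) (f : C -> C) (z : C) : cdiff f z -> cdiff (fun w => k * f w)%C z.
Proof. intros H. apply cdiff_mult; [apply cdiff_const | assumption]. Qed.

Lemma cdiff_minus (f g : C -> C) (z : C) :
  cdiff f z -> cdiff g z -> cdiff (fun w => f w - g w)%C z.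
Proof.
  intros [p [Hp Ep]] [q [Hq Eq]]. exists (fun w => p w - q w)%C.
  split; [now apply cont_minus|]. intros w. rewrite (Ep w), (Eq w). ring.
Qed.

Lemma cdiff_comp (g f : C -> C) (z : C) :
  cdiff f z -> cdiff g (f z) -> cdiff (fun w => g (f w)) z.
Proof.
  intros Hf Hg. pose proof (cdiff_cont _ _ Hf) as Cf.
  destruct Hf as [p [Hp Ep]], Hg as [q [Hq Eq]].
  exists (fun w => q (f w) * p w)%C. split.
  - apply cont_mult; [now apply cont_comp | assumption].
  - intros w. assert (E : (f w - f z = p w * (w - z))%C) by (rewrite (Ep w); ring).
    rewrite (Eq (f w)), E. ring.
Qed.

Lemma cdiff_pow (f : C -> C) (n : nat) (z : C) : cdiff f z -> cdiff (fun w => f w ^ n)%C z.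
Proof.
  intros Hf. induction n as [|n IH]; simpl; [apply cdiff_const | now apply cdiff_mult].
Qed.

Lemma cdiff_inv (z : C) : z <> RtoC 0 -> cdiff Cinv z.
Proof.
  intros Hz. pose proof (proj1 (Cmod_gt_0 z) Hz) as Pz.
  (* The quotient is [-1/(w z)] away from [w = 0], where [/ 0] needs a separate value. *)
  exists (fun w => if Ceq_dec w (RtoC 0) then (/ z / z - / w / z)%C else (- / w / z)%C).
  split.
  - apply (cont_local (fun w => - (1) * / w * / z)%C _ _ (Cmod z)); [assumption| |].
    + intros w Hw. destruct (Ceq_dec w (RtoC 0)) as [->|nw].
      * exfalso. replace (RtoC 0 - z)%C with (- z)%C in Hw by ring. rewrite Cmod_opp in Hw. lra.
      * unfold Cdiv. ring.
    + apply cont_mult; [|apply cont_const]. apply cont_mult; [apply cont_const|].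
      now apply cont_inv.
  - intros w. destruct (Ceq_dec w (RtoC 0)) as [->|nw].
    + replace (/ z + (/ z / z - / RtoC 0 / z) * (RtoC 0 - z))%C
        with (/ z - (/ z / z * z) + / RtoC 0 * (/ z * z))%C by (unfold Cdiv; ring).
      unfold Cdiv. rewrite <- (Cmult_assoc (/ z) (/ z) z), Cinv_l by assumption. ring.
    + field. auto.
Qed.

Lemma cdiff_conj (f : C -> C) (z : C) :
  cdiff f (Cconj z) -> cdiff (fun w => Cconj (f (Cconj w))) z.
Proof.
  intros [p [Hp Ep]]. exists (fun w => Cconj (p (Cconj w))). split.
  - apply cont_comp; [|apply cont_conj]. apply cont_comp; [apply cont_conj | assumption].
  - intros w. rewrite (Ep (Cconj w)), Cplus_conj, Cmult_conj, Cminus_conj, !Cconj_conj. reflexivity.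
Qed.

Lemma cdiff_iff (f : C -> C) (z : C) :
  cdiff f z <-> exists L : C, forall eps, 0 < eps -> exists d, 0 < d /\
    forall w, Cmod (w - z) < d -> Cmod (f w - f z - L * (w - z)) <= eps * Cmod (w - z).
Proof.
  split.
  - intros [p [Hp Ep]]. exists (p z). intros e He. destruct (Hp e He) as [d [Hd H]].
    exists d. split; [assumption|]. intros w Hw. rewrite (Ep w).
    replace (f z + p w * (w - z) - f z - p z * (w - z))%C with ((p w - p z) * (w - z))%C by ring.
    rewrite Cmod_mult. apply Rmult_le_compat_r; [apply Cmod_ge_0|]. left; auto.
  - intros [L H].
    exists (fun w => if Ceq_dec w z then L else ((f w - f z) / (w - z))%C). split.
    + intros e He. destruct (H (e/2)) as [d [Hd H']]; [lra|]. exists d. split; [assumption|].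
      intros w Hw. destruct (Ceq_dec z z) as [_|n]; [|now destruct n].
      destruct (Ceq_dec w z) as [->|n]; [now rewrite Cmod_diag|].
      pose proof (Cminus_eq_contra _ _ n) as n'.
      replace ((f w - f z) / (w - z) - L)%C with ((f w - f z - L * (w - z)) / (w - z))%C by (field; assumption).
      rewrite Cmod_div by assumption. pose proof (proj1 (Cmod_gt_0 _) n') as P.
      apply Rle_lt_trans with (e/2); [|lra].
      apply Rmult_le_reg_r with (Cmod (w - z)); [assumption|].
      unfold Rdiv at 1. rewrite Rmult_assoc, Rinv_l by lra. rewrite Rmult_1_r. now apply H'.
    + intros w. destruct (Ceq_dec w z) as [->|n]; [ring|].
      field. now apply Cminus_eq_contra.
Qed.

(** The identity in [cdiff] is demanded at every [w], so locality is obtained through the epsilon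
    form, which only sees points near [z]. *)
Lemma cdiff_local (f g : C -> C) (z : C) (r : R) :
  0 < r -> (forall w, Cmod (w - z) < r -> f w = g w) -> cdiff f z -> cdiff g z.
Proof.
  intros Hr E Hf. apply cdiff_iff in Hf. apply cdiff_iff. destruct Hf as [L H]. exists L.
  intros e He. destruct (H e He) as [d [Hd H']].
  exists (Rmin r d). split; [now apply Rmin_glb_lt|]. intros w Hw.
  rewrite <- !E.
  - apply H'. eapply Rlt_le_trans; [exact Hw | apply Rmin_r].
  - now rewrite Cmod_diag.
  - eapply Rlt_le_trans; [exact Hw | apply Rmin_l].
Qed.

(** * Integrals over boundaries of boxes *)

Definition CInt (f : R -> C) (a b : R) : C :=
  (RInt (fun t => fst (f t)) a b, RInt (fun t => snd (f t)) a b).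

Definition rcont (f : R -> C) : Prop :=
  forall t, continuous (fun s => fst (f s)) t /\ continuous (fun s => snd (f s)) t.

Lemma continuous_eps (f : R -> R) (t : R) :
  (forall eps, 0 < eps -> exists d, 0 < d /\ forall s, Rabs (s - t) < d -> Rabs (f s - f t) < eps) ->
  continuous f t.
Proof.
  intros H. apply continuity_pt_filterlim. intros e He. destruct (H e He) as [d [Hd H']].
  exists d. split; [assumption|]. intros x [_ Hx]. now apply H'.
Qed.

Lemma rcont_comp (f : C -> C) (g : R -> C) :
  (forall s t, Cmod (g s - g t) = Rabs (s - t)) -> (forall t, cont f (g t)) ->
  rcont (fun t => f (g t)).
Proof.
  intros Hg Hf t. split; apply continuous_eps; intros e He;
    destruct (Hf t e He) as [d [Hd H]]; exists d; (split; [assumption|]); intros s Hs.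
  - eapply Rle_lt_trans; [|apply (H (g s)); now rewrite Hg].
    apply (fst_le_Cmod (f (g s) - f (g t))%C).
  - eapply Rle_lt_trans; [|apply (H (g s)); now rewrite Hg].
    apply (snd_le_Cmod (f (g s) - f (g t))%C).
Qed.

Lemma Cmod_real (x : R) : Cmod (x, 0) = Rabs x.
Proof. apply (Cmod_R x). Qed.

Lemma Cmod_imag (y : R) : Cmod (0, y) = Rabs y.
Proof.
  unfold Cmod; simpl. rewrite Rmult_0_l, Rplus_0_l, Rmult_1_r. apply sqrt_Rsqr_abs.
Qed.

Lemma hor_isometry (c s t : R) : Cmod ((s, c) - (t, c)) = Rabs (s - t).
Proof.
  rewrite <- Cmod_real. f_equal. unfold Cminus, Cplus, Copp; simpl. f_equal; ring.
Qed.

Lemma ver_isometry (c s t : R) : Cmod ((c, s) - (c, t)) = Rabs (s - t).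
Proof.
  rewrite <- Cmod_imag. f_equal. unfold Cminus, Cplus, Copp; simpl. f_equal; ring.
Qed.

Lemma ex_RInt_cont (f : R -> R) (a b : R) : (forall t, continuous f t) -> ex_RInt f a b.
Proof. intros H. apply (ex_RInt_continuous (V := R_CompleteNormedModule)). auto. Qed.

Lemma CInt_ext (f g : R -> C) (a b : R) :
  a <= b -> (forall t, a <= t <= b -> f t = g t) -> CInt f a b = CInt g a b.
Proof.
  intros Hab E. unfold CInt. f_equal; apply RInt_ext; rewrite Rmin_left, Rmax_right by assumption;
    intros x Hx; rewrite E; auto; lra.
Qed.

Lemma CInt_plus (f g : R -> C) (a b : R) : rcont f -> rcont g ->
  CInt (fun t => f t + g t)%C a b = (CInt f a b + CInt g a b)%C.
Proof.
  intros Hf Hg. unfold CInt, Cplus; simpl.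
  f_equal; apply (RInt_plus (V := R_CompleteNormedModule)); apply ex_RInt_cont; intros t;
    first [apply (Hf t) | apply (Hg t)].
Qed.

Lemma CInt_scal (k : C) (f : R -> C) (a b : R) : rcont f ->
  CInt (fun t => k * f t)%C a b = (k * CInt f a b)%C.
Proof.
  intros Hf.
  assert (E1 : ex_RInt (fun t => fst (f t)) a b) by (apply ex_RInt_cont; intros t; apply (Hf t)).
  assert (E2 : ex_RInt (fun t => snd (f t)) a b) by (apply ex_RInt_cont; intros t; apply (Hf t)).
  unfold CInt, Cmult; simpl.
  assert (S1 : forall l, ex_RInt (fun t => l * fst (f t)) a b)
    by (intros l; apply (ex_RInt_scal (V := R_NormedModule) (fun t => fst (f t)) a b l E1)).
  assert (S2 : forall l, ex_RInt (fun t => l * snd (f t)) a b)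
    by (intros l; apply (ex_RInt_scal (V := R_NormedModule) (fun t => snd (f t)) a b l E2)).
  pose proof (fun l => RInt_scal (V := R_CompleteNormedModule) (fun t => fst (f t)) a b l E1) as I1.
  pose proof (fun l => RInt_scal (V := R_CompleteNormedModule) (fun t => snd (f t)) a b l E2) as I2.
  change (scal (V := R_CompleteNormedModule)) with Rmult in I1, I2.
  f_equal.
  - rewrite <- I1, <- I2.
    apply (RInt_minus (V := R_CompleteNormedModule) _ _ _ _ (S1 (fst k)) (S2 (snd k))).
  - rewrite <- I1, <- I2.
    apply (RInt_plus (V := R_CompleteNormedModule) _ _ _ _ (S2 (fst k)) (S1 (snd k))).
Qed.

Lemma CInt_Chasles (f : R -> C) (a b c : R) : rcont f ->
  (CInt f a b + CInt f b c)%C = CInt f a c.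
Proof.
  intros Hf. unfold CInt, Cplus; simpl.
  f_equal; apply (RInt_Chasles (V := R_CompleteNormedModule)); apply ex_RInt_cont; intros t; apply (Hf t).
Qed.

Lemma CInt_bound (f : R -> C) (a b m : R) : rcont f -> a <= b ->
  (forall t, a <= t <= b -> Cmod (f t) <= m) -> Cmod (CInt f a b) <= m * (b - a).
Proof.
  intros Hf Hab Hm.
  rewrite Cmod_norm. apply (norm_RInt_le (V := C_R_NormedModule) f (fun _ => m) a b (CInt f a b) (m * (b - a)) Hab).
  - intros t Ht. rewrite <- Cmod_norm. auto.
  - apply (is_RInt_fct_extend_pair (U := R_NormedModule) (V := R_NormedModule));
      apply (RInt_correct (V := R_CompleteNormedModule)), ex_RInt_cont; intros t; apply (Hf t).
  - replace (m * (b - a)) with (scal (b - a) m) by (unfold scal; simpl; unfold mult; simpl; ring).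
    apply (is_RInt_const (V := R_NormedModule)).
Qed.

(** Extensionality of integrals leaves equations typed in the carrier of a normed module, while
    [ring] needs the type [R] itself. *)
Ltac rring := match goal with |- @eq _ ?x ?y => change (@eq R x y); ring end.

Lemma CInt_affine (A B : C) (a b : R) :
  CInt (fun t => A + B * RtoC t)%C a b = (A * RtoC (b - a) + B * RtoC ((b * b - a * a) / 2))%C.
Proof.
  assert (K : forall p q : R, RInt (fun t => p + q * t) a b = p * (b - a) + q * ((b * b - a * a) / 2)).
  { intros p q. apply is_RInt_unique.
    replace (p * (b - a) + q * ((b * b - a * a) / 2))
      with (minus (p * b + q * (b * b / 2)) (p * a + q * (a * a / 2)))
      by (unfold minus, plus, opp; simpl; field).
    apply (is_RInt_derive (V := R_CompleteNormedModule) (fun t => p * t + q * (t * t / 2)) (fun t => p + q * t)).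
    - intros x _. auto_derive; [trivial | field].
    - intros x _. apply (ex_derive_continuous (fun t => p + q * t)). auto_derive; trivial. }
  unfold CInt, RtoC, Cplus, Cmult; simpl. f_equal.
  - transitivity (RInt (fun t => fst A + fst B * t) a b); [|rewrite K; rring].
    apply RInt_ext; intros; rring.
  - transitivity (RInt (fun t => snd A + snd B * t) a b); [|rewrite K; rring].
    apply RInt_ext; intros; rring.
Qed.

Definition inbox (a b c d : R) (z : C) : Prop := a <= fst z <= b /\ c <= snd z <= d.
Definition inobox (a b c d : R) (z : C) : Prop := a < fst z < b /\ c < snd z < d.
(** Whole lines rather than segments: continuity on them makes the integrand of each side continuous
    in every real parameter, as [rcont] demands. Kernels with pole in the open box qualify, since
    these lines avoid it. *)
Definition onsides (a b c d : R) (z : C) : Prop :=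
  fst z = a \/ fst z = b \/ snd z = c \/ snd z = d.

(** The counterclockwise contour integral; [Ci] comes from [dw = i dy] on the vertical sides. *)
Definition bint (f : C -> C) (a b c d : R) : C :=
  (CInt (fun x => f (x, c)) a b - CInt (fun x => f (x, d)) a b
   + Ci * (CInt (fun y => f (b, y)) c d - CInt (fun y => f (a, y)) c d))%C.

Definition bcont (f : C -> C) (a b c d : R) : Prop := forall z, onsides a b c d z -> cont f z.

Lemma rcont_hor (f : C -> C) (c : R) : (forall x, cont f (x, c)) -> rcont (fun x => f (x, c)).
Proof. intros H. apply (rcont_comp f (fun x => (x, c))); [apply hor_isometry | auto]. Qed.

Lemma rcont_ver (f : C -> C) (c : R) : (forall y, cont f (c, y)) -> rcont (fun y => f (c, y)).
Proof. intros H. apply (rcont_comp f (fun y => (c, y))); [apply ver_isometry | auto]. Qed.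

Lemma bcont_sides (f : C -> C) (a b c d : R) : bcont f a b c d ->
  rcont (fun x => f (x, c)) /\ rcont (fun x => f (x, d)) /\
  rcont (fun y => f (a, y)) /\ rcont (fun y => f (b, y)).
Proof.
  intros H. repeat split; try apply rcont_hor; try apply rcont_ver; intros x; apply H; unfold onsides; simpl; auto.
Qed.

Lemma bcont_cont (f : C -> C) (a b c d : R) : (forall z, cont f z) -> bcont f a b c d.
Proof. intros H z _. apply H. Qed.

Lemma bint_plus (f g : C -> C) (a b c d : R) : bcont f a b c d -> bcont g a b c d ->
  bint (fun z => f z + g z)%C a b c d = (bint f a b c d + bint g a b c d)%C.
Proof.
  intros Hf Hg. apply bcont_sides in Hf, Hg. destruct Hf as [? [? [? ?]]], Hg as [? [? [? ?]]].
  unfold bint. rewrite !CInt_plus by assumption. ring.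
Qed.

Lemma bint_scal (k : C) (f : C -> C) (a b c d : R) : bcont f a b c d ->
  bint (fun z => k * f z)%C a b c d = (k * bint f a b c d)%C.
Proof.
  intros Hf. apply bcont_sides in Hf. destruct Hf as [? [? [? ?]]].
  unfold bint. rewrite !CInt_scal by assumption. ring.
Qed.

Lemma bint_ext (f g : C -> C) (a b c d : R) : a <= b -> c <= d ->
  (forall z, inbox a b c d z -> onsides a b c d z -> f z = g z) ->
  bint f a b c d = bint g a b c d.
Proof.
  intros Hab Hcd E. unfold bint.
  f_equal; [|f_equal]; f_equal; try (f_equal; apply CInt_ext); try apply CInt_ext; try assumption;
    intros t Ht; apply E; unfold inbox, onsides; simpl; auto; lra.
Qed.

Lemma bint_bound (f : C -> C) (a b c d m : R) : a <= b -> c <= d -> bcont f a b c d ->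
  (forall z, inbox a b c d z -> onsides a b c d z -> Cmod (f z) <= m) ->
  Cmod (bint f a b c d) <= m * (2 * (b - a + (d - c))).
Proof.
  intros Hab Hcd Hf Hm. apply bcont_sides in Hf. destruct Hf as [H1 [H2 [H3 H4]]].
  unfold bint.
  assert (B1 : Cmod (CInt (fun x => f (x, c)) a b) <= m * (b - a)).
  { apply CInt_bound; auto. intros t Ht. apply Hm; unfold inbox, onsides; simpl; auto; lra. }
  assert (B2 : Cmod (CInt (fun x => f (x, d)) a b) <= m * (b - a)).
  { apply CInt_bound; auto. intros t Ht. apply Hm; unfold inbox, onsides; simpl; auto; lra. }
  assert (B3 : Cmod (CInt (fun y => f (a, y)) c d) <= m * (d - c)).
  { apply CInt_bound; auto. intros t Ht. apply Hm; unfold inbox, onsides; simpl; auto; lra. }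
  assert (B4 : Cmod (CInt (fun y => f (b, y)) c d) <= m * (d - c)).
  { apply CInt_bound; auto. intros t Ht. apply Hm; unfold inbox, onsides; simpl; auto; lra. }
  eapply Rle_trans; [apply Cmod_triangle|]. rewrite Cmod_mult, Cmod_Ci, Rmult_1_l.
  eapply Rle_trans; [apply Rplus_le_compat; apply Cmod_triangle|]. rewrite !Cmod_opp. lra.
Qed.

Lemma bint_split_x (f : C -> C) (a e b c d : R) :
  (forall z, snd z = c \/ snd z = d -> cont f z) ->
  bint f a b c d = (bint f a e c d + bint f e b c d)%C.
Proof.
  intros H. unfold bint.
  rewrite <- (CInt_Chasles (fun x => f (x, c)) a e b) by (apply rcont_hor; intros; apply H; auto).
  rewrite <- (CInt_Chasles (fun x => f (x, d)) a e b) by (apply rcont_hor; intros; apply H; auto).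
  ring.
Qed.

Lemma bint_split_y (f : C -> C) (a b c e d : R) :
  (forall z, fst z = a \/ fst z = b -> cont f z) ->
  bint f a b c d = (bint f a b c e + bint f a b e d)%C.
Proof.
  intros H. unfold bint.
  rewrite <- (CInt_Chasles (fun y => f (a, y)) c e d) by (apply rcont_ver; intros; apply H; auto).
  rewrite <- (CInt_Chasles (fun y => f (b, y)) c e d) by (apply rcont_ver; intros; apply H; auto).
  ring.
Qed.

Lemma bint_split4 (f : C -> C) (a e b c g d : R) : (forall z, cont f z) ->
  bint f a b c d = (bint f a e c g + bint f e b c g + (bint f a e g d + bint f e b g d))%C.
Proof.
  intros H. rewrite (bint_split_y f a b c g d), (bint_split_x f a e b c g), (bint_split_x f a e b g d); auto.
Qed.

Lemma bint_affine (A B : C) (a b c d : R) : bint (fun z => A + B * z)%C a b c d = RtoC 0.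
Proof.
  assert (E1 : forall c, CInt (fun x => A + B * (x, c))%C a b = CInt (fun x => (A + B * (0, c)) + B * RtoC x)%C a b).
  { intros e. f_equal. apply functional_extensionality. intros x.
    unfold RtoC, Cplus, Cmult; simpl; f_equal; ring. }
  assert (E2 : forall a, CInt (fun y => A + B * (a, y))%C c d = CInt (fun y => (A + B * RtoC a) + (B * Ci) * RtoC y)%C c d).
  { intros e. f_equal. apply functional_extensionality. intros x.
    unfold RtoC, Cplus, Cmult, Ci; simpl; f_equal; ring. }
  unfold bint. rewrite !E1, !E2, !CInt_affine.
  unfold RtoC, Cplus, Cmult, Ci, Cminus, Copp; simpl; f_equal; field.
Qed.

(** * Goursat's lemma *)

Lemma nested_limit (x L : nat -> R) : (forall n, 0 <= L n) ->
  (forall n, x n <= x (S n) /\ x (S n) + L (S n) <= x n + L n) ->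
  exists p, forall n, x n <= p <= x n + L n.
Proof.
  intros Pos H.
  assert (Up : forall n m, (n <= m)%nat -> x n <= x m /\ x m + L m <= x n + L n).
  { intros n m Hnm. induction Hnm as [|m Hnm IH]; [lra|]. specialize (H m). lra. }
  assert (Up' : forall n m, x m <= x n + L n).
  { intros n m. destruct (Nat.le_ge_cases n m) as [h|h]; pose proof (Up _ _ h);
      pose proof (Pos m); pose proof (Pos n); lra. }
  destruct (completeness (fun y => exists n, y = x n)) as [p [Hub Hlub]].
  - exists (x 0%nat + L 0%nat). intros y [n ->]. apply Up'.
  - now exists (x 0%nat), 0%nat.
  - exists p. intros n. split; [apply Hub; now exists n|].
    apply Hlub. intros y [m ->]. apply Up'.
Qed.

Lemma small_pow2 (L e : R) : 0 < e -> exists n, L / 2 ^ n < e.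
Proof.
  intros He. destruct (Pow_x_infinity 2 ltac:(rewrite Rabs_pos_eq; lra) (Rabs L / e + 1)) as [n Hn].
  exists n. specialize (Hn n (Nat.le_refl n)).
  assert (P : 0 < 2 ^ n) by (apply pow_lt; lra).
  rewrite Rabs_pos_eq in Hn by lra.
  apply Rmult_lt_reg_r with (2 ^ n); [assumption|].
  unfold Rdiv. rewrite Rmult_assoc, Rinv_l, Rmult_1_r by lra.
  assert (Rabs L / e * e = Rabs L) by (field; lra).
  pose proof (Rle_abs L). nra.
Qed.

(** Compactness of the box, in the form that serves boundedness, uniform continuity and Goursat's
    lemma alike: if [P] failed, some quarter would fail again and again, and the nested quarters
    would close in on a point near which [P] holds. *)
Lemma bisect (P : R -> R -> R -> R -> Prop) (a b c d : R) : a <= b -> c <= d ->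
  (forall a' b' c' d', a' <= b' -> c' <= d' ->
    let e := (a' + b') / 2 in let g := (c' + d') / 2 in
    P a' e c' g -> P e b' c' g -> P a' e g d' -> P e b' g d' -> P a' b' c' d') ->
  (forall p, inbox a b c d p -> exists r, 0 < r /\ forall a' b' c' d',
    a <= a' -> b' <= b -> c <= c' -> d' <= d -> inbox a' b' c' d' p ->
    b' - a' + (d' - c') < r -> P a' b' c' d') ->
  P a b c d.
Proof.
  intros Hab Hcd Glue Loc. apply NNPP. intros Bad.
  set (L := b - a). set (H := d - c).
  (* A box after [n] halvings is determined by its lower left corner [s]. *)
  set (bad := fun (s : R * R) (n : nat) =>
    ~ P (fst s) (fst s + L / 2 ^ n) (snd s) (snd s + H / 2 ^ n)).
  assert (HL : 0 <= L) by (unfold L; lra). assert (HH : 0 <= H) by (unfold H; lra).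
  assert (Half : forall K n, K / 2 ^ n = K / 2 ^ S n + K / 2 ^ S n).
  { intros K n. simpl. field. apply pow_nonzero. lra. }
  assert (Pos : forall K n, 0 <= K -> 0 <= K / 2 ^ n).
  { intros K n HK. apply Rmult_le_pos; [assumption|]. left. apply Rinv_0_lt_compat, pow_lt. lra. }
  assert (Step : forall s n, bad s n -> exists s', bad s' (S n) /\
    (fst s <= fst s' /\ fst s' + L / 2 ^ S n <= fst s + L / 2 ^ n) /\
    (snd s <= snd s' /\ snd s' + H / 2 ^ S n <= snd s + H / 2 ^ n)).
  { intros [x y] n Hb. unfold bad in Hb; simpl fst in *; simpl snd in *.
    pose proof (Half L n) as EL. pose proof (Half H n) as EH.
    pose proof (Pos L (S n) HL). pose proof (Pos H (S n) HH).
    set (l := L / 2 ^ S n) in *. set (h := H / 2 ^ S n) in *.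
    apply NNPP. intros No. apply Hb. rewrite EL, EH. clear Hb.
    assert (Ok : forall x' y', (x' = x \/ x' = x + l) -> (y' = y \/ y' = y + h) -> P x' (x' + l) y' (y' + h)).
    { intros x' y' Hx Hy. apply NNPP. intros Nok. apply No. exists (x', y').
      split; [exact Nok|]. simpl fst; simpl snd. fold l h. rewrite EL, EH.
      destruct Hx, Hy; subst; lra. }
    apply Glue; try lra; replace ((x + (x + (l + l))) / 2) with (x + l) by field;
      replace ((y + (y + (h + h))) / 2) with (y + h) by field;
      rewrite <- ?(Rplus_assoc _ l l), <- ?(Rplus_assoc _ h h); apply Ok; auto. }
  set (step := fun (n : nat) (s : {s | bad s n}) =>
    let w := constructive_indefinite_description _ (Step (proj1_sig s) n (proj2_sig s)) in
    exist (fun s' => bad s' (S n)) (proj1_sig w) (proj1 (proj2_sig w))).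
  assert (Bad0 : bad (a, c) 0%nat).
  { unfold bad; simpl. unfold Rdiv. rewrite Rinv_1, !Rmult_1_r. unfold L, H.
    replace (a + (b - a)) with b by ring. now replace (c + (d - c)) with d by ring. }
  set (sq := fix sq n : {s | bad s n} :=
    match n with O => exist (fun s => bad s 0%nat) (a, c) Bad0 | S m => step m (sq m) end).
  set (x := fun n => fst (proj1_sig (sq n))). set (y := fun n => snd (proj1_sig (sq n))).
  assert (Nest : forall n, (x n <= x (S n) /\ x (S n) + L / 2 ^ S n <= x n + L / 2 ^ n) /\
                           (y n <= y (S n) /\ y (S n) + H / 2 ^ S n <= y n + H / 2 ^ n)).
  { intros n. unfold x, y. change (sq (S n)) with (step n (sq n)). unfold step; cbn [proj1_sig].
    exact (proj2 (proj2_sig (constructive_indefinite_description _ (Step (proj1_sig (sq n)) n (proj2_sig (sq n)))))). }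
  destruct (nested_limit x (fun n => L / 2 ^ n) (fun n => Pos L n HL) (fun n => proj1 (Nest n))) as [p Hp].
  destruct (nested_limit y (fun n => H / 2 ^ n) (fun n => Pos H n HH) (fun n => proj2 (Nest n))) as [q Hq].
  assert (In : forall n, a <= x n /\ x n + L / 2 ^ n <= b /\ c <= y n /\ y n + H / 2 ^ n <= d).
  { intros n. induction n as [|n IH].
    - unfold x, y; simpl. unfold Rdiv. rewrite Rinv_1, !Rmult_1_r. unfold L, H. lra.
    - pose proof (Nest n). lra. }
  destruct (Loc (p, q)) as [r [Hr Hloc]].
  { pose proof (In 0%nat). pose proof (Hp 0%nat). pose proof (Hq 0%nat). unfold inbox; simpl fst; simpl snd. lra. }
  destruct (small_pow2 (L + H) r Hr) as [n Hn].
  destruct (sq n) as [s Hs] eqn:E. apply Hs.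
  pose proof (In n) as I1. pose proof (Hp n) as I2. pose proof (Hq n) as I3.
  unfold x, y in I1, I2, I3. rewrite E in I1, I2, I3. cbn [proj1_sig] in I1, I2, I3.
  apply Hloc; try lra.
  unfold inbox; simpl fst; simpl snd. lra.
Qed.

Lemma inbox_dist (a b c d : R) (p z : C) : inbox a b c d p -> inbox a b c d z ->
  Cmod (z - p) <= b - a + (d - c).
Proof.
  intros Hp Hz. eapply Rle_trans; [apply Cmod_le_sum|]. unfold inbox in *.
  unfold Cminus, Cplus, Copp; simpl. apply Rplus_le_compat; apply Rabs_le; lra.
Qed.

Lemma inbox_cases (a b c d : R) (z : C) :
  let e := (a + b) / 2 in let g := (c + d) / 2 in
  inbox a b c d z ->
  inbox a e c g z \/ inbox e b c g z \/ inbox a e g d z \/ inbox e b g d z.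
Proof.
  unfold inbox. intros H. destruct (Rle_dec (fst z) ((a + b) / 2)), (Rle_dec (snd z) ((c + d) / 2)); lra.
Qed.

Lemma box_bounded (f : C -> C) (a b c d : R) : a <= b -> c <= d ->
  (forall z, cont f z) -> exists M, 0 < M /\ forall z, inbox a b c d z -> Cmod (f z) <= M.
Proof.
  intros Hab Hcd Hf.
  apply (bisect (fun a b c d => exists M, 0 < M /\ forall z, inbox a b c d z -> Cmod (f z) <= M)); try assumption.
  - intros a' b' c' d' _ _ e g [M1 [P1 H1]] [M2 [P2 H2]] [M3 [P3 H3]] [M4 [P4 H4]].
    exists (M1 + M2 + M3 + M4). split; [lra|]. intros z Hz.
    destruct (inbox_cases _ _ _ _ _ Hz) as [h|[h|[h|h]]];
      [specialize (H1 z h)|specialize (H2 z h)|specialize (H3 z h)|specialize (H4 z h)]; lra.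
  - intros p _. destruct (Hf p 1 Rlt_0_1) as [r [Hr H]]. exists r. split; [assumption|].
    intros a' b' c' d' _ _ _ _ Hp Hs. exists (Cmod (f p) + 1). split; [pose proof (Cmod_ge_0 (f p)); lra|].
    intros z Hz. pose proof (inbox_dist _ _ _ _ _ _ Hp Hz).
    pose proof (Cmod_triangle (f z - f p) (f p)) as T.
    replace (f z - f p + f p)%C with (f z) in T by ring.
    specialize (H z ltac:(lra)). lra.
Qed.

Lemma box_uniform (f : C -> C) (a b c d eps : R) : a <= b -> c <= d -> 0 < eps ->
  (forall z, cont f z) -> exists r, 0 < r /\
    forall z w, inbox a b c d z -> Cmod (w - z) < r -> Cmod (f w - f z) < eps.
Proof.
  intros Hab Hcd He Hf.
  apply (bisect (fun a b c d => exists r, 0 < r /\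
    forall z w, inbox a b c d z -> Cmod (w - z) < r -> Cmod (f w - f z) < eps)); try assumption.
  - intros a' b' c' d' _ _ e g [M1 [P1 H1]] [M2 [P2 H2]] [M3 [P3 H3]] [M4 [P4 H4]].
    exists (Rmin (Rmin M1 M2) (Rmin M3 M4)). split; [repeat apply Rmin_glb_lt; assumption|].
    intros z w Hz Hw.
    pose proof (Rmin_l (Rmin M1 M2) (Rmin M3 M4)). pose proof (Rmin_r (Rmin M1 M2) (Rmin M3 M4)).
    pose proof (Rmin_l M1 M2). pose proof (Rmin_r M1 M2). pose proof (Rmin_l M3 M4). pose proof (Rmin_r M3 M4).
    destruct (inbox_cases _ _ _ _ _ Hz) as [h|[h|[h|h]]];
      [apply (H1 z w h)|apply (H2 z w h)|apply (H3 z w h)|apply (H4 z w h)]; lra.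
  - intros p _. destruct (Hf p (eps / 2) ltac:(lra)) as [r [Hr H]]. exists (r / 2). split; [lra|].
    intros a' b' c' d' _ _ _ _ Hp Hs. exists (r / 2). split; [lra|].
    intros z w Hz Hw. pose proof (inbox_dist _ _ _ _ _ _ Hp Hz).
    pose proof (Cmod_triangle_minus w z p).
    pose proof (H z ltac:(lra)). pose proof (H w ltac:(lra)).
    pose proof (Cmod_triangle_minus (f w) (f p) (f z)). rewrite (Cmod_sym (f p) (f z)) in *. lra.
Qed.

(** The bound in [Key] is quadratic in the half-perimeter, so the bounds of four quarters add up
    exactly to that of the whole. Near a point of differentiability the affine part integrates to
    zero, and the remainder is at most [e] times the half-perimeter on a contour of twice that
    length. *)
Lemma goursat_closed (f : C -> C) (a b c d : R) : a <= b -> c <= d ->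
  (forall z, cont f z) -> (forall z, inbox a b c d z -> cdiff f z) -> bint f a b c d = RtoC 0.
Proof.
  intros Hab Hcd Hf Hd.
  assert (Key : forall e, 0 < e -> Cmod (bint f a b c d) <= 2 * e * (b - a + (d - c)) ^ 2).
  { intros e He.
    apply (bisect (fun a b c d => Cmod (bint f a b c d) <= 2 * e * (b - a + (d - c)) ^ 2)); try assumption.
    - intros a' b' c' d' _ _ x y B1 B2 B3 B4. rewrite (bint_split4 f a' x b' c' y d' Hf).
      eapply Rle_trans; [apply Cmod_triangle|].
      eapply Rle_trans; [apply Rplus_le_compat; apply Cmod_triangle|].
      unfold x, y in *. nra.
    - intros p Hp. destruct (proj1 (cdiff_iff f p) (Hd p Hp)) as [L HL].
      destruct (HL e He) as [r [Hr H]]. exists r. split; [assumption|].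
      intros a' b' c' d' _ _ _ _ Hp' Hs.
      set (A := (f p - L * p)%C).
      assert (Cr : bcont (fun z => f z - (A + L * z))%C a' b' c' d').
      { apply bcont_cont. intros z. apply cont_minus; [apply Hf|].
        apply cont_plus; [apply cont_const|]. apply cont_mult; [apply cont_const | apply cont_id]. }
      assert (Ca : bcont (fun z => A + L * z)%C a' b' c' d').
      { apply bcont_cont. intros z.
        apply cont_plus; [apply cont_const|]. apply cont_mult; [apply cont_const | apply cont_id]. }
      assert (Hbox : a' <= b' /\ c' <= d') by (unfold inbox in Hp'; lra).
      rewrite (bint_ext f (fun z => (f z - (A + L * z)) + (A + L * z))%C) by (try tauto; intros; ring).
      rewrite (bint_plus _ _ _ _ _ _ Cr Ca), bint_affine, Cplus_0_r.
      eapply Rle_trans.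
      + apply (bint_bound _ a' b' c' d' (e * (b' - a' + (d' - c')))); try tauto.
        intros z Hz _. pose proof (inbox_dist _ _ _ _ _ _ Hp' Hz) as Dz.
        replace (f z - (A + L * z))%C with (f z - f p - L * (z - p))%C by (unfold A; ring).
        eapply Rle_trans; [apply H; lra|]. apply Rmult_le_compat_l; lra.
      + right. ring. }
  apply Cmod_eq_0. apply Rle_antisym; [|apply Cmod_ge_0].
  apply Rnot_lt_le. intros P.
  set (K := (b - a + (d - c)) ^ 2) in *. assert (0 <= K) by apply pow2_ge_0.
  set (m := Cmod (bint f a b c d)) in *.
  specialize (Key (m / (4 * (K + 1)))).
  assert (0 < m / (4 * (K + 1))) by (apply Rdiv_lt_0_compat; lra).
  assert (E : m / (4 * (K + 1)) * (4 * (K + 1)) = m) by (field; lra).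
  specialize (Key ltac:(assumption)). nra.
Qed.

Theorem goursat (f : C -> C) (a b c d : R) : a <= b -> c <= d ->
  (forall z, cont f z) -> (forall z, inobox a b c d z -> cdiff f z) -> bint f a b c d = RtoC 0.
Proof.
  intros Hab Hcd Hf Hd.
  (* A box without interior has to be treated apart: no contraction moves it into its open box. *)
  destruct (Req_dec a b) as [->|nab].
  { unfold bint, CInt. rewrite !RInt_point. apply injective_projections; simpl; unfold zero; simpl; ring. }
  destruct (Req_dec c d) as [->|ncd].
  { unfold bint, CInt. rewrite !RInt_point. apply injective_projections; simpl; unfold zero; simpl; ring. }
  apply Cmod_eq_0. apply Rle_antisym; [|apply Cmod_ge_0].
  set (S := 2 * (b - a + (d - c))). assert (HS : 0 < S) by (unfold S; lra).
  apply Rnot_lt_le. intros P.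
  set (m := Cmod (bint f a b c d)) in *.
  set (e := m / (2 * S)). assert (He : 0 < e) by (apply Rdiv_lt_0_compat; lra).
  destruct (box_uniform f a b c d e Hab Hcd He Hf) as [r [Hr H]].
  (* Contracting towards the center moves the closed box into the open one. *)
  set (s := Rmin (1 / 2) (r / (2 * S))).
  assert (Hs : 0 < s) by (apply Rmin_glb_lt; [lra | apply Rdiv_lt_0_compat; lra]).
  assert (Hs1 : s <= 1 / 2) by apply Rmin_l.
  assert (Hs2 : s * S < r).
  { apply Rle_lt_trans with (r / (2 * S) * S); [apply Rmult_le_compat_r; [lra | apply Rmin_r]|].
    replace (r / (2 * S) * S) with (r / 2) by (field; lra). lra. }
  set (k := ((a + b) / 2, (c + d) / 2) : C).
  set (T := fun z : C => (k + RtoC (1 - s) * (z - k))%C).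
  assert (Tc : forall z, cont T z).
  { intros z. apply cont_plus; [apply cont_const|]. apply cont_mult; [apply cont_const|].
    apply cont_minus; [apply cont_id | apply cont_const]. }
  assert (Td : forall z, cdiff T z).
  { intros z. apply cdiff_plus; [apply cdiff_const|]. apply cdiff_mult; [apply cdiff_const|].
    apply cdiff_minus; [apply cdiff_id | apply cdiff_const]. }
  assert (G : bint (fun z => f (T z)) a b c d = RtoC 0).
  { apply goursat_closed; try assumption.
    - intros z. apply cont_comp; auto.
    - intros z Hz. apply cdiff_comp; [apply Td|]. apply Hd.
      unfold inobox, inbox, T, k in *; simpl. nra. }
  assert (Cg : bcont (fun z => f (T z)) a b c d) by (apply bcont_cont; intros; apply cont_comp; auto).
  assert (Cd : bcont (fun z => f z - f (T z))%C a b c d).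
  { apply bcont_cont; intros; apply cont_minus; [apply Hf|]. apply cont_comp; auto. }
  assert (B : m <= e * S).
  { unfold m. rewrite (bint_ext f (fun z => (f z - f (T z)) + f (T z))%C) by (try assumption; intros; ring).
    rewrite (bint_plus _ _ _ _ _ _ Cd Cg), G, Cplus_0_r.
    apply bint_bound; try assumption. intros z Hz _. rewrite Cmod_sym. left. apply H; [assumption|].
    replace (T z - z)%C with (RtoC s * (k - z))%C by (unfold T; rewrite RtoC_minus; ring).
    rewrite Cmod_mult, Cmod_R, Rabs_pos_eq by lra.
    apply Rle_lt_trans with (s * S); [|assumption]. apply Rmult_le_compat_l; [lra|].
    apply Rle_trans with (b - a + (d - c)); [|unfold S; lra].
    apply inbox_dist; [assumption|]. unfold inbox, k; simpl; lra. }
  replace (e * S) with (m / 2) in B by (unfold e; field; lra). lra.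
Qed.

(** * Cauchy's formula and its consequences *)

Lemma inobox_margin (a b c d : R) (z : C) : inobox a b c d z ->
  exists r, 0 < r /\ (forall w, onsides a b c d w -> r <= Cmod (w - z)) /\
    (forall w, Cmod (w - z) < r -> inobox a b c d w).
Proof.
  intros [[H1 H2] [H3 H4]].
  exists (Rmin (Rmin (fst z - a) (b - fst z)) (Rmin (snd z - c) (d - snd z))).
  set (r := Rmin (Rmin (fst z - a) (b - fst z)) (Rmin (snd z - c) (d - snd z))).
  assert (R1 : r <= fst z - a) by (eapply Rle_trans; [apply Rmin_l | apply Rmin_l]).
  assert (R2 : r <= b - fst z) by (eapply Rle_trans; [apply Rmin_l | apply Rmin_r]).
  assert (R3 : r <= snd z - c) by (eapply Rle_trans; [apply Rmin_r | apply Rmin_l]).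
  assert (R4 : r <= d - snd z) by (eapply Rle_trans; [apply Rmin_r | apply Rmin_r]).
  split; [repeat apply Rmin_glb_lt; lra|]. split; intros w Hw;
    pose proof (fst_le_Cmod (w - z)) as F; pose proof (snd_le_Cmod (w - z)) as G;
    change (fst (w - z)%C) with (fst w - fst z) in F; change (snd (w - z)%C) with (snd w - snd z) in G.
  - destruct Hw as [E|[E|[E|E]]]; rewrite E in *; revert F G; unfold Rabs; repeat destruct Rcase_abs; intros; lra.
  - unfold inobox. revert F G; unfold Rabs; repeat destruct Rcase_abs; intros; lra.
Qed.

Lemma cont_kernel (z w : C) : w <> z -> cont (fun w => / (w - z))%C w.
Proof.
  intros H. apply (cont_comp Cinv (fun w => (w - z)%C)).
  - apply cont_minus; [apply cont_id | apply cont_const].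
  - apply cont_inv. now apply Cminus_eq_contra.
Qed.

Lemma cdiff_kernel (z w : C) : w <> z -> cdiff (fun w => / (w - z))%C w.
Proof.
  intros H. apply (cdiff_comp Cinv (fun w => (w - z)%C)).
  - apply cdiff_minus; [apply cdiff_id | apply cdiff_const].
  - apply cdiff_inv. now apply Cminus_eq_contra.
Qed.

Lemma onsides_neq (a b c d : R) (z w : C) : inobox a b c d z -> onsides a b c d w -> w <> z.
Proof. unfold inobox, onsides. intros H K ->. lra. Qed.

Definition kappa (a b c d : R) (z : C) : C := bint (fun w => / (w - z))%C a b c d.

Lemma bcont_kernel (a b c d : R) (z : C) : inobox a b c d z -> bcont (fun w => / (w - z))%C a b c d.
Proof. intros Hz w Hw. apply cont_kernel. now apply (onsides_neq a b c d). Qed.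

Lemma RInt_lt_0 (f : R -> R) (a b : R) : a < b -> (forall x, f x < 0) ->
  (forall x, continuous f x) -> RInt f a b < 0.
Proof.
  intros Hab Hf Cf. apply Ropp_lt_cancel. rewrite Ropp_0.
  rewrite <- (RInt_opp (V := R_CompleteNormedModule)) by (now apply ex_RInt_cont).
  apply RInt_gt_0; [assumption| |].
  - intros x _. apply Ropp_0_gt_lt_contravar, Hf.
  - intros x _. apply (continuous_opp (V := R_NormedModule)), Cf.
Qed.

(* Each side contributes positively to the imaginary part. *)
Lemma kappa_neq_0 (a b c d : R) (z : C) : inobox a b c d z -> kappa a b c d z <> RtoC 0.
Proof.
  intros Hz E. apply (f_equal snd) in E. revert E.
  destruct (bcont_sides _ _ _ _ _ (bcont_kernel _ _ _ _ _ Hz)) as [S1 [S2 [S3 S4]]].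
  destruct z as [p q], Hz as [[H1 H2] [H3 H4]]; simpl in H1, H2, H3, H4.
  unfold kappa, bint, CInt, Cminus, Cplus, Cmult, Copp, Ci. simpl fst; simpl snd.
  set (I1 := RInt _ a b). set (I2 := RInt _ a b). set (I3 := RInt _ c d). set (I4 := RInt _ c d).
  set (J1 := RInt _ c d). set (J2 := RInt _ c d).
  assert (D : forall x y, x <> 0 \/ y <> 0 -> 0 < x * (x * 1) + y * (y * 1)) by (intros x y [n|n]; nra).
  assert (P1 : 0 < I1).
  { apply RInt_gt_0; [lra| |intros x _; apply (S1 x)].
    intros x _. apply Rdiv_lt_0_compat; [lra | apply D; lra]. }
  assert (P2 : I2 < 0).
  { apply RInt_lt_0; [lra| |intros x; apply (S2 x)].
    intros x. simpl. apply Rdiv_neg_pos; [lra | apply D; lra]. }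
  assert (P3 : 0 < J1).
  { apply RInt_gt_0; [lra| |intros x _; apply (S4 x)].
    intros x _. apply Rdiv_lt_0_compat; [lra | apply D; lra]. }
  assert (P4 : J2 < 0).
  { apply RInt_lt_0; [lra| |intros x; apply (S3 x)].
    intros x. simpl. apply Rdiv_neg_pos; [lra | apply D; lra]. }
  lra.
Qed.

(** The difference quotient [phi] of [f] at [z] is continuous everywhere and differentiable off [z].
    Cutting the box at [z] puts the exceptional point on the corners of four boxes, where Goursat's
    lemma asks for continuity only; hence [phi] integrates to zero. *)
Theorem cauchy_formula (f : C -> C) (a b c d : R) (z : C) :
  (forall w, cont f w) -> (forall w, inobox a b c d w -> cdiff f w) -> inobox a b c d z ->
  bint (fun w => f w * / (w - z))%C a b c d = (f z * kappa a b c d z)%C.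
Proof.
  intros Hf Hd Hz. destruct (Hd z Hz) as [phi [Cphi Ephi]].
  assert (E : forall w, w <> z -> phi w = ((f w - f z) * / (w - z))%C).
  { intros w n. rewrite (Ephi w). field. now apply Cminus_eq_contra. }
  assert (Loc : forall w, w <> z -> forall v, Cmod (v - w) < Cmod (w - z) ->
    ((f v - f z) * / (v - z))%C = phi v).
  { intros w n v Hv. symmetry. apply E. intros ->. rewrite Cmod_sym in Hv. lra. }
  assert (Pos : forall w, w <> z -> 0 < Cmod (w - z)) by (intros w n; apply Cmod_gt_0; now apply Cminus_eq_contra).
  assert (Cont : forall w, cont phi w).
  { intros w. destruct (Ceq_dec w z) as [->|n]; [assumption|].
    apply (cont_local _ _ _ _ (Pos w n) (Loc w n)). apply cont_mult; [|now apply cont_kernel].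
    apply cont_minus; [apply Hf | apply cont_const]. }
  assert (Diff : forall w, inobox a b c d w -> w <> z -> cdiff phi w).
  { intros w Hw n. apply (cdiff_local _ _ _ _ (Pos w n) (Loc w n)). apply cdiff_mult; [|now apply cdiff_kernel].
    apply cdiff_minus; [now apply Hd | apply cdiff_const]. }
  assert (Hbox : a <= b /\ c <= d) by (unfold inobox in Hz; lra).
  assert (Z : bint phi a b c d = RtoC 0).
  { rewrite (bint_split4 phi a (fst z) b c (snd z) d Cont), !goursat; try ring; try assumption;
      try (unfold inobox in Hz; lra);
      intros w Hw; (apply Diff; [unfold inobox in *; lra | intros ->; unfold inobox in Hw; lra]). }
  pose proof (bcont_kernel _ _ _ _ _ Hz) as Ck.
  rewrite (bint_ext _ (fun w => phi w + f z * / (w - z))%C).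
  - rewrite bint_plus, Z, bint_scal; [unfold kappa; ring | assumption | now apply bcont_cont |].
    intros w Hw. apply cont_mult; [apply cont_const | now apply Ck].
  - tauto.
  - tauto.
  - intros w _ Hw. rewrite E by (now apply (onsides_neq a b c d)). ring.
Qed.

(** Taking [n]-th roots makes the constants disappear. In the maximum principle they are
    [Cmod kappa] and the length of the contour over the distance to it, the same for all powers of
    [f]. *)
Lemma pow_compare (x m k K : R) : 0 <= x -> 0 <= m -> 0 < k ->
  (forall n, x ^ n * k <= m ^ n * K) -> x <= m.
Proof.
  intros Hx Hm Hk H. apply Rnot_lt_le. intros Lt.
  destruct (Req_dec m 0) as [->|nm].
  { specialize (H 1%nat). simpl in H. nra. }
  assert (Hm' : 0 < m) by lra.
  assert (Q : 1 < x / m).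
  { apply Rmult_lt_reg_r with m; [assumption|]. unfold Rdiv. rewrite Rmult_assoc, Rinv_l; lra. }
  destruct (Pow_x_infinity (x / m) ltac:(rewrite Rabs_pos_eq; lra) (Rabs K / k + 1)) as [n Hn].
  specialize (Hn n (Nat.le_refl n)).
  rewrite Rabs_pos_eq in Hn by (apply pow_le; lra).
  specialize (H n).
  assert (E : x ^ n = (x / m) ^ n * m ^ n).
  { rewrite <- Rpow_mult_distr. f_equal. field. lra. }
  rewrite E in H. assert (P : 0 < m ^ n) by (now apply pow_lt).
  assert (H' : (x / m) ^ n * k <= K) by nra.
  assert (Rabs K / k * k = Rabs K) by (field; lra).
  pose proof (Rle_abs K). nra.
Qed.

Theorem maximum_principle (f : C -> C) (a b c d m : R) (z : C) :
  (forall w, cont f w) -> (forall w, inobox a b c d w -> cdiff f w) ->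
  (forall w, inbox a b c d w -> onsides a b c d w -> Cmod (f w) <= m) ->
  inbox a b c d z -> Cmod (f z) <= m.
Proof.
  intros Hf Hd Hm Hz.
  destruct (excluded_middle_informative (onsides a b c d z)) as [S|S]; [now apply Hm|].
  assert (Hz' : inobox a b c d z).
  { unfold inbox, inobox, onsides in *.
    repeat split; apply Rnot_le_lt; intros G; apply S; lra. }
  assert (Hbox : a <= b /\ c <= d) by (unfold inobox in Hz'; lra).
  destruct (inobox_margin _ _ _ _ _ Hz') as [r [Hr [Hr1 _]]].
  pose proof (kappa_neq_0 _ _ _ _ _ Hz') as Hk. apply Cmod_gt_0 in Hk.
  assert (m_pos : 0 <= m).
  { eapply Rle_trans; [apply (Cmod_ge_0 (f (a, c)))|]. apply Hm; unfold inbox, onsides; simpl; auto; lra. }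
  apply (pow_compare _ _ (Cmod (kappa a b c d z)) (/ r * (2 * (b - a + (d - c))))); try assumption.
  { apply Cmod_ge_0. }
  intros n. rewrite <- Cmod_pow, <- Cmod_mult.
  rewrite <- (cauchy_formula (fun w => f w ^ n)%C a b c d z).
  - rewrite <- Rmult_assoc. apply bint_bound; try tauto.
    + intros w Hw. apply cont_mult; [now apply cont_pow | now apply (bcont_kernel a b c d)].
    + intros w Hw Sw. rewrite Cmod_mult, Cmod_pow, Cmod_inv.
      * apply Rmult_le_compat; try (apply pow_le; apply Cmod_ge_0).
        -- left. apply Rinv_0_lt_compat. specialize (Hr1 w Sw). lra.
        -- apply pow_incr. split; [apply Cmod_ge_0 | now apply Hm].
        -- apply Rinv_le_contravar; auto.
      * apply Cminus_eq_contra. now apply (onsides_neq a b c d).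
  - intros w. now apply cont_pow.
  - intros w Hw. apply cdiff_pow. auto.
  - assumption.
Qed.

(** The kernel is expanded exactly as [1/(w-u) = 1/(w-z) + (u-z)/(w-z)^2 + (u-z)^2/((w-u)(w-z)^2)].
    The second term gives the derivative; the third is quadratic in [u - z], with a constant [K]
    uniform for [u] within [r / 2] of [z]. *)
Lemma cauchy_integral_cdiff (g : C -> C) (a b c d : R) (z : C) :
  (forall w, cont g w) -> inobox a b c d z ->
  cdiff (fun u => bint (fun w => g w * / (w - u))%C a b c d) z.
Proof.
  intros Hg Hz.
  assert (Hbox : a <= b /\ c <= d) by (unfold inobox in Hz; lra).
  destruct (box_bounded g a b c d (proj1 Hbox) (proj2 Hbox) Hg) as [M [HM Mb]].
  destruct (inobox_margin _ _ _ _ _ Hz) as [r [Hr [Hr1 Hr2]]].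
  pose proof (bcont_kernel _ _ _ _ _ Hz) as Kz.
  apply cdiff_iff. exists (bint (fun w => g w * (/ (w - z) * / (w - z)))%C a b c d).
  set (K := M * (/ (r / 2) * (/ r * / r)) * (2 * (b - a + (d - c)))).
  assert (Pi : 0 < / r) by (now apply Rinv_0_lt_compat).
  assert (Pi2 : 0 < / (r / 2)) by (apply Rinv_0_lt_compat; lra).
  assert (HK : 0 <= K).
  { unfold K. apply Rmult_le_pos; [|lra]. apply Rmult_le_pos; [lra|].
    left. repeat apply Rmult_lt_0_compat; assumption. }
  intros e He. exists (Rmin (r / 2) (e / (K + 1))).
  split; [apply Rmin_glb_lt; [lra | apply Rdiv_lt_0_compat; lra]|]. intros u Hu.
  pose proof (Rlt_le_trans _ _ _ Hu (Rmin_l _ _)) as U1.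
  pose proof (Rlt_le_trans _ _ _ Hu (Rmin_r _ _)) as U2.
  assert (Hu' : inobox a b c d u) by (apply Hr2; lra).
  pose proof (bcont_kernel _ _ _ _ _ Hu') as Ku.
  assert (B1 : bcont (fun w => g w * / (w - z))%C a b c d).
  { intros w Hw. apply cont_mult; auto. }
  assert (B2 : bcont (fun w => g w * (/ (w - z) * / (w - z)))%C a b c d).
  { intros w Hw. apply cont_mult; auto. apply cont_mult; auto. }
  assert (B3 : bcont (fun w => g w * (/ (w - u) * (/ (w - z) * / (w - z))))%C a b c d).
  { intros w Hw. apply cont_mult; auto. apply cont_mult; auto. apply cont_mult; auto. }
  assert (B2' : bcont (fun w => (u - z) * (g w * (/ (w - z) * / (w - z))))%C a b c d).
  { intros w Hw. apply cont_mult; [apply cont_const|]. now apply B2. }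
  assert (B3' : bcont (fun w => (u - z) * (u - z) * (g w * (/ (w - u) * (/ (w - z) * / (w - z)))))%C a b c d).
  { intros w Hw. apply cont_mult; [apply cont_const|]. now apply B3. }
  rewrite (bint_ext (fun w => g w * / (w - u))%C
    (fun w => g w * / (w - z) + ((u - z) * (g w * (/ (w - z) * / (w - z)))
      + (u - z) * (u - z) * (g w * (/ (w - u) * (/ (w - z) * / (w - z))))))%C); try tauto.
  - rewrite bint_plus, bint_plus, bint_scal, bint_scal; try assumption.
    2: { intros w Hw. apply cont_plus; auto. }
    match goal with |- Cmod ?x <= _ =>
      replace x with ((u - z) * (u - z) * bint (fun w => g w * (/ (w - u) * (/ (w - z) * / (w - z))))%C a b c d)%C by ring end.
    assert (B : Cmod (bint (fun w => g w * (/ (w - u) * (/ (w - z) * / (w - z))))%C a b c d) <= K).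
    { apply bint_bound; try tauto. intros w Hw Sw.
      pose proof (onsides_neq _ _ _ _ _ _ Hz Sw). pose proof (onsides_neq _ _ _ _ _ _ Hu' Sw).
      pose proof (Hr1 w Sw) as D1.
      assert (D2 : r / 2 <= Cmod (w - u)).
      { pose proof (Cmod_triangle_minus w u z). lra. }
      rewrite !Cmod_mult, !Cmod_inv by (now apply Cminus_eq_contra).
      pose proof (Rinv_le_contravar _ _ Hr D1). pose proof (Rinv_le_contravar (r / 2) _ ltac:(lra) D2).
      assert (0 <= / Cmod (w - z)) by (left; apply Rinv_0_lt_compat; lra).
      assert (0 <= / Cmod (w - u)) by (left; apply Rinv_0_lt_compat; lra).
      apply Rmult_le_compat; [apply Cmod_ge_0 | | now apply Mb |].
      - repeat apply Rmult_le_pos; assumption.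
      - apply Rmult_le_compat; try assumption; [now apply Rmult_le_pos|]. now apply Rmult_le_compat. }
    rewrite !Cmod_mult. pose proof (Cmod_ge_0 (u - z)) as P.
    assert (Cmod (u - z) * (K + 1) <= e).
    { apply Rle_trans with (e / (K + 1) * (K + 1)); [apply Rmult_le_compat_r; lra|]. right. field. lra. }
    rewrite Rmult_assoc, (Rmult_comm e). apply Rmult_le_compat_l; [assumption|]. nra.
  - intros w _ Hw. pose proof (onsides_neq _ _ _ _ _ _ Hz Hw). pose proof (onsides_neq _ _ _ _ _ _ Hu' Hw).
    field. split; now apply Cminus_eq_contra.
Qed.

(** Cauchy's formula survives uniform limits, so [g] is the quotient of its Cauchy integral by
    [kappa]. Both are differentiable as Cauchy integrals, [kappa] being that of the constant 1. *)
Theorem uniform_limit_cdiff (g : C -> C) (a b c d : R) (z : C) :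
  (forall w, cont g w) ->
  (forall e, 0 < e -> exists f, (forall w, cont f w) /\ (forall w, inobox a b c d w -> cdiff f w) /\
    forall w, inbox a b c d w -> Cmod (f w - g w) <= e) ->
  inobox a b c d z -> cdiff g z.
Proof.
  intros Hg App Hz0.
  assert (Hbox : a <= b /\ c <= d) by (unfold inobox in Hz0; lra).
  assert (Key : forall u, inobox a b c d u ->
    bint (fun w => g w * / (w - u))%C a b c d = (g u * kappa a b c d u)%C).
  { intros u Hz. destruct (inobox_margin _ _ _ _ _ Hz) as [r [Hr [Hr1 _]]].
    pose proof (bcont_kernel _ _ _ _ _ Hz) as Kz.
    apply Ceq_minus, Cmod_eq_0. apply Rle_antisym; [|apply Cmod_ge_0].
    set (x := Cmod _). set (K := / r * (2 * (b - a + (d - c))) + Cmod (kappa a b c d u)).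
    assert (Pi : 0 < / r) by (now apply Rinv_0_lt_compat).
    assert (HK : 0 <= K).
    { unfold K. pose proof (Cmod_ge_0 (kappa a b c d u)).
      assert (0 <= / r * (2 * (b - a + (d - c)))) by (apply Rmult_le_pos; lra). lra. }
    assert (Hx : forall e, 0 < e -> x <= e * K).
    { intros e He. destruct (App e He) as [f [Cf [Df Ef]]].
      assert (Bg : bcont (fun w => (g w - f w) * / (w - u))%C a b c d).
      { intros w Hw. apply cont_mult; auto. apply cont_minus; auto. }
      assert (Bf : bcont (fun w => f w * / (w - u))%C a b c d).
      { intros w Hw. apply cont_mult; auto. }
      unfold x.
      rewrite (bint_ext _ (fun w => (g w - f w) * / (w - u) + f w * / (w - u))%C) by (try tauto; intros; ring).
      rewrite (bint_plus _ _ _ _ _ _ Bg Bf), (cauchy_formula f a b c d u Cf Df Hz).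
      match goal with |- Cmod (?I + ?B - ?D) <= _ =>
        replace (I + B - D)%C with (I + (f u - g u) * kappa a b c d u)%C by ring end.
      eapply Rle_trans; [apply Cmod_triangle|]. unfold K. rewrite Rmult_plus_distr_l.
      apply Rplus_le_compat.
      - rewrite <- Rmult_assoc. apply bint_bound; try tauto. intros w Hw Sw.
        rewrite Cmod_mult, Cmod_inv by (apply Cminus_eq_contra; now apply (onsides_neq a b c d)).
        apply Rmult_le_compat; [apply Cmod_ge_0| | |].
        + left. apply Rinv_0_lt_compat. specialize (Hr1 w Sw). lra.
        + rewrite Cmod_sym. auto.
        + apply Rinv_le_contravar; auto.
      - rewrite Cmod_mult. apply Rmult_le_compat_r; [apply Cmod_ge_0|]. apply Ef.
        unfold inobox, inbox in *. lra. }
    apply Rnot_lt_le. intros P. specialize (Hx (x / (2 * (K + 1))) ltac:(apply Rdiv_lt_0_compat; lra)).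
    assert (x / (2 * (K + 1)) * (2 * (K + 1)) = x) by (field; lra).
    assert (0 < x / (2 * (K + 1))) by (apply Rdiv_lt_0_compat; lra). nra. }
  destruct (inobox_margin _ _ _ _ _ Hz0) as [r [Hr [_ Hr2]]].
  apply (cdiff_local (fun u => bint (fun w => g w * / (w - u))%C a b c d * / kappa a b c d u)%C _ _ r Hr).
  - intros u Hu. apply Hr2 in Hu. rewrite Key by assumption.
    field. now apply kappa_neq_0.
  - apply cdiff_mult; [now apply cauchy_integral_cdiff|].
    apply (cdiff_comp Cinv (kappa a b c d)).
    + apply (cdiff_local (fun u => bint (fun w => RtoC 1 * / (w - u))%C a b c d) _ _ 1 Rlt_0_1).
      * intros u _. apply bint_ext; try tauto. intros; ring.
      * apply cauchy_integral_cdiff; [intros; apply cont_const | assumption].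
    + apply cdiff_inv. now apply kappa_neq_0.
Qed.

(** * The two-constants theorem *)

(** Continuity on the plane stands for continuity on the closed box, from which it can be recovered
    by [clamp]. Only the values on the closed box carry information. *)
Definition holo (a b c d : R) (f : C -> C) : Prop :=
  (forall w, cont f w) /\ (forall w, inobox a b c d w -> cdiff f w).

Lemma inbox_sub (a b c d a' b' c' d' : R) (w : C) :
  a' <= a -> b <= b' -> c' <= c -> d <= d' -> inbox a b c d w -> inbox a' b' c' d' w.
Proof. unfold inbox. intros. lra. Qed.

Lemma inobox_sub (a b c d a' b' c' d' : R) (w : C) :
  a' <= a -> b <= b' -> c' <= c -> d <= d' -> inobox a b c d w -> inobox a' b' c' d' w.
Proof. unfold inobox. intros. lra. Qed.

Lemma holo_sub (a b c d a' b' c' d' : R) (f : C -> C) :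
  a' <= a -> b <= b' -> c' <= c -> d <= d' -> holo a' b' c' d' f -> holo a b c d f.
Proof.
  intros H1 H2 H3 H4 [C D]. split; [assumption|]. intros w Hw. apply D. revert Hw.
  now apply inobox_sub.
Qed.

Lemma holo_minus (a b c d : R) (f g : C -> C) :
  holo a b c d f -> holo a b c d g -> holo a b c d (fun w => f w - g w)%C.
Proof. intros [C D] [C' D']. split; intros; [apply cont_minus | apply cdiff_minus]; auto. Qed.

Lemma holo_mult (a b c d : R) (f g : C -> C) :
  holo a b c d f -> holo a b c d g -> holo a b c d (fun w => f w * g w)%C.
Proof. intros [C D] [C' D']. split; intros; [apply cont_mult | apply cdiff_mult]; auto. Qed.

Lemma entire_holo (a b c d : R) (f : C -> C) : (forall w, cdiff f w) -> holo a b c d f.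
Proof. intros H. split; intros; auto using cdiff_cont. Qed.

Lemma holo_conj (a b c d : R) (f : C -> C) :
  holo a b c d f -> holo a b (- d) (- c) (fun w => Cconj (f (Cconj w))).
Proof.
  intros [C D]. split.
  - intros w. apply cont_comp; [|apply cont_conj]. apply cont_comp; [apply cont_conj | apply C].
  - intros w Hw. apply cdiff_conj, D. unfold inobox in *; simpl. lra.
Qed.

(* With [w = (zeta - z) / r], the polynomial [1 + (1/2 + 2 i w - w^2) / 8] has modulus at most 1 on
   the vertical sides and the top of the half box, and modulus above 1 near the center of its
   bottom: its powers play the role of the exponential of harmonic measure. *)
Definition barrier (z r : R) (w : C) : C :=
  let v := (/ RtoC r * (w - RtoC z))%C in
  (RtoC 1 + RtoC (1 / 8) * (RtoC (1 / 2) + RtoC 2 * Ci * v - v * v))%C.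

Lemma barrier_entire (z r : R) (w : C) : cdiff (barrier z r) w.
Proof.
  assert (V : cdiff (fun w => / RtoC r * (w - RtoC z))%C w).
  { apply cdiff_scal, cdiff_minus; [apply cdiff_id | apply cdiff_const]. }
  unfold barrier. apply cdiff_plus; [apply cdiff_const|]. apply cdiff_scal.
  apply cdiff_minus; [|now apply cdiff_mult].
  apply cdiff_plus; [apply cdiff_const|]. now apply cdiff_scal.
Qed.

Lemma barrier_coord (z r x y : R) : 0 < r ->
  barrier z r ((z + r * x)%R, (r * y)%R) =
  (1 + (1/2 - 2 * y - x * x + y * y) / 8, (2 * x - 2 * x * y) / 8).
Proof.
  intros Hr. unfold barrier.
  replace (/ RtoC r * (((z + r * x)%R, (r * y)%R) - RtoC z))%C with ((x, y) : C).
  - unfold Ci, RtoC, Cplus, Cmult, Cminus, Copp; simpl. f_equal; field.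
  - rewrite <- RtoC_inv by lra. unfold RtoC, Cplus, Cmult, Cminus, Copp; simpl. f_equal; field; lra.
Qed.

Lemma Cmod_le_of_sq (z : C) (m : R) : 0 <= m -> fst z ^ 2 + snd z ^ 2 <= m ^ 2 -> Cmod z <= m.
Proof. intros Hm H. unfold Cmod. rewrite <- (sqrt_pow2 m Hm). now apply sqrt_le_1_alt. Qed.

Lemma box_coord (z r c : R) (w : C) : 0 < r -> inbox (z - r) (z + r) c r w ->
  exists x y, w = (z + r * x, r * y) /\ -1 <= x <= 1 /\ y <= 1 /\ c <= r * y /\
    fst w - z = r * x /\ snd w = r * y.
Proof.
  intros Hr [H1 H2]. destruct w as [p q]; simpl in *. exists ((p - z) / r), (q / r).
  assert (E1 : r * ((p - z) / r) = p - z) by (field; lra).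
  assert (E2 : r * (q / r) = q) by (field; lra).
  rewrite E1, E2. split; [f_equal; lra|]. repeat split; try lra; nra.
Qed.

(** The maximum principle is applied to [f * barrier ^ n]. That [e] is fixed before [f] lets the
    estimate act uniformly on all differences of approximants. *)
Theorem two_constants (z r M eta : R) : 0 < r -> 0 < M -> 0 < eta ->
  exists e, 0 < e /\ forall f, holo (z - r) (z + r) 0 r f ->
    (forall w, inbox (z - r) (z + r) 0 r w -> Cmod (f w) <= M) ->
    (forall x, Rabs (x - z) <= r -> Cmod (f (x, 0)) <= e) ->
    forall w, inbox (z - r / 16) (z + r / 16) 0 (r / 16) w -> Cmod (f w) <= eta.
Proof.
  intros Hr HM He.
  (* [33 / 32] is a lower bound of the barrier on the small box, so dividing by [n] powers of it
     brings [M] below [eta]. *)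
  destruct (Pow_x_infinity (33 / 32) ltac:(rewrite Rabs_pos_eq; lra) (M / eta)) as [n Hn].
  specialize (Hn n (Nat.le_refl n)). rewrite Rabs_pos_eq in Hn by (apply pow_le; lra).
  assert (P2 : 0 < 2 ^ n) by (apply pow_lt; lra).
  assert (P3 : 0 < (33 / 32) ^ n) by (apply pow_lt; lra).
  (* On the bottom side the barrier has modulus at most 2, so there [f * barrier ^ n] stays below
     [M]. *)
  exists (M / 2 ^ n). split; [now apply Rdiv_lt_0_compat|].
  intros f Hf Mf Ef w Hw.
  assert (Hw' : inbox (z - r) (z + r) 0 r w) by (revert Hw; apply inbox_sub; lra).
  assert (Hg : holo (z - r) (z + r) 0 r (fun w => f w * barrier z r w ^ n)%C).
  { apply holo_mult; [assumption|]. apply entire_holo. intros v. apply cdiff_pow, barrier_entire. }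
  assert (B : Cmod (f w * barrier z r w ^ n) <= M).
  { apply (maximum_principle (fun w => f w * barrier z r w ^ n)%C (z - r) (z + r) 0 r M w); try apply Hg; [|assumption].
    intros v Hv Sv. rewrite Cmod_mult, Cmod_pow.
    destruct (box_coord z r 0 v Hr Hv) as [x [y [Ev [Hx [Hy [Hy0 [Ex Ey]]]]]]].
    assert (0 <= y) by nra.
    destruct (Req_dec y 0) as [Y|Y].
    - rewrite Ev, barrier_coord by assumption. subst y.
      rewrite Rmult_0_r in *. apply Rle_trans with (M / 2 ^ n * 2 ^ n); [|right; field; lra].
      apply Rmult_le_compat; [apply Cmod_ge_0 | apply pow_le, Cmod_ge_0 | |].
      + apply Ef. apply Rabs_le. nra.
      + apply pow_incr. split; [apply Cmod_ge_0|]. apply Cmod_le_of_sq; [lra|]. simpl fst; simpl snd.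
        assert (Hxx : 0 <= x * x <= 1) by nra.
        match goal with |- ?l <= _ => replace l with ((17 / 16 - x * x / 8) ^ 2 + x * x / 16) by field end.
        nra.
    - rewrite <- (Rmult_1_r M). apply Rmult_le_compat; [apply Cmod_ge_0 | apply pow_le, Cmod_ge_0 | auto |].
      rewrite <- (pow1 n). apply pow_incr. split; [apply Cmod_ge_0|].
      rewrite Ev, barrier_coord by assumption. apply Cmod_le_of_sq; [lra|]. simpl fst; simpl snd.
      set (q := 1/2 - 2 * y - x * x + y * y). set (p := 2 * x - 2 * x * y).
      (* On the other three sides the squared modulus [(1 + q/8)^2 + p^2/64] is then at most
         [(15/16)^2 + 1/16 < 1]. *)
      assert (Hq : q <= - (1 / 2)).
      { unfold q. assert (C : x = -1 \/ x = 1 \/ y = 1).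
        { destruct Sv as [S|[S|[S|S]]]; [left | right; left | exfalso; apply Y | right; right];
            apply (Rmult_eq_reg_l r); lra. }
        destruct C as [E|[E|E]]; rewrite E; nra. }
      assert (Hq' : - (3 / 2) <= q) by (unfold q; nra).
      assert (Hp : p ^ 2 <= 4).
      { unfold p. replace ((2 * x - 2 * x * y) ^ 2) with (4 * (x * x) * ((1 - y) * (1 - y))) by ring.
        assert (x * x <= 1) by nra. assert ((1 - y) * (1 - y) <= 1) by nra.
        assert (0 <= x * x) by nra. assert (0 <= (1 - y) * (1 - y)) by nra. nra. }
      nra. }
  rewrite Cmod_mult, Cmod_pow in B.
  assert (L : 33 / 32 <= Cmod (barrier z r w)).
  { assert (I : inbox (z - r) (z + r) 0 r w) by assumption.
    destruct (box_coord z r 0 w Hr I) as [x [y [Ev [Hx [Hy [Hy0 [Ex Ey]]]]]]].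
    rewrite Ev, barrier_coord by assumption.
    eapply Rle_trans; [|apply fst_le_Cmod]. simpl fst.
    destruct Hw as [W1 W2]. assert (0 <= y <= 1 / 16) by nra. assert (- (1 / 16) <= x <= 1 / 16) by nra.
    eapply Rle_trans; [|apply Rle_abs]. nra. }
  pose proof (pow_incr (33 / 32) (Cmod (barrier z r w)) n ltac:(lra)) as L'.
  set (X := Cmod (barrier z r w) ^ n) in *. pose proof (Cmod_ge_0 (f w)).
  assert (M <= eta * X).
  { apply Rle_trans with (eta * (33 / 32) ^ n); [|apply Rmult_le_compat_l; lra].
    replace M with (eta * (M / eta)) by (field; lra). apply Rmult_le_compat_l; lra. }
  nra.
Qed.

(** * Uniform limits of holomorphic functions on a closed box, and extension from approximation *)

Lemma clamp_lip (a b x y : R) : a <= b ->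
  Rabs (Rmax a (Rmin b x) - Rmax a (Rmin b y)) <= Rabs (x - y).
Proof.
  intros H. unfold Rmax, Rmin, Rabs. repeat destruct Rle_dec; repeat destruct Rcase_abs; lra.
Qed.

(** The nearest-point retraction onto the closed box. Precomposing with it extends a function
    continuous on the box continuously to the plane. *)
Definition clamp (a b c d : R) (w : C) : C :=
  (Rmax a (Rmin b (fst w)), Rmax c (Rmin d (snd w))).

Lemma clamp_cont (a b c d : R) (w : C) : a <= b -> c <= d -> cont (clamp a b c d) w.
Proof.
  intros Hab Hcd e He. exists (e / 2). split; [lra|]. intros v Hv.
  eapply Rle_lt_trans; [apply Cmod_le_sum|].
  unfold clamp, Cminus at 1 2, Cplus, Copp; simpl.
  pose proof (clamp_lip a b (fst v) (fst w) Hab). pose proof (clamp_lip c d (snd v) (snd w) Hcd).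
  pose proof (fst_le_Cmod (v - w)) as F. pose proof (snd_le_Cmod (v - w)) as G.
  change (fst (v - w)%C) with (fst v - fst w) in F. change (snd (v - w)%C) with (snd v - snd w) in G.
  unfold Rminus in *. lra.
Qed.

Lemma clamp_in (a b c d : R) (w : C) : a <= b -> c <= d -> inbox a b c d (clamp a b c d w).
Proof.
  intros Hab Hcd. unfold inbox, clamp; simpl. unfold Rmax, Rmin. repeat destruct Rle_dec; lra.
Qed.

Lemma clamp_id (a b c d : R) (w : C) : inbox a b c d w -> clamp a b c d w = w.
Proof.
  intros [H1 H2]. destruct w as [x y]. unfold clamp; simpl in *.
  unfold Rmax, Rmin. f_equal; repeat destruct Rle_dec; lra.
Qed.

Lemma uniform_cauchy_limit (fs : nat -> C -> C) (B : C -> Prop) :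
  (forall e, 0 < e -> exists N, forall n m, (N <= n)%nat -> (N <= m)%nat ->
    forall w, B w -> Cmod (fs n w - fs m w) <= e) ->
  exists g, forall e, 0 < e -> exists N, forall n, (N <= n)%nat ->
    forall w, B w -> Cmod (fs n w - g w) <= e.
Proof.
  intros H.
  assert (L : forall w, exists l : C, B w ->
    forall e, 0 < e -> exists N, forall n, (N <= n)%nat -> Cmod (fs n w - l) <= e).
  { intros w. destruct (excluded_middle_informative (B w)) as [Bw|n]; [|now exists (RtoC 0)].
    assert (C1 : Cauchy_crit (fun n => fst (fs n w))).
    { intros e He. destruct (H (e / 2) ltac:(lra)) as [N HN]. exists N. intros n m Hn Hm.
      specialize (HN n m Hn Hm w Bw). pose proof (fst_le_Cmod (fs n w - fs m w)) as F.
      change (fst (fs n w - fs m w)%C) with (fst (fs n w) - fst (fs m w)) in F. unfold Rdist. lra. }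
    assert (C2 : Cauchy_crit (fun n => snd (fs n w))).
    { intros e He. destruct (H (e / 2) ltac:(lra)) as [N HN]. exists N. intros n m Hn Hm.
      specialize (HN n m Hn Hm w Bw). pose proof (snd_le_Cmod (fs n w - fs m w)) as F.
      change (snd (fs n w - fs m w)%C) with (snd (fs n w) - snd (fs m w)) in F. unfold Rdist. lra. }
    destruct (Rcomplete.R_complete _ C1) as [l1 L1]. destruct (Rcomplete.R_complete _ C2) as [l2 L2].
    exists (l1, l2). intros _ e He.
    destruct (L1 (e / 2) ltac:(lra)) as [N1 H1]. destruct (L2 (e / 2) ltac:(lra)) as [N2 H2].
    exists (Nat.max N1 N2). intros n Hn. eapply Rle_trans; [apply Cmod_le_sum|].
    specialize (H1 n ltac:(lia)). specialize (H2 n ltac:(lia)). unfold Rdist in *.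
    unfold Cminus, Cplus, Copp; simpl. unfold Rminus in *. lra. }
  destruct (choice _ L) as [g Hg]. exists g. intros e He.
  destruct (H (e / 2) ltac:(lra)) as [N HN]. exists N. intros n Hn w Bw.
  destruct (Hg w Bw (e / 2) ltac:(lra)) as [N' HN'].
  pose proof (HN n (Nat.max N N') Hn ltac:(lia) w Bw). pose proof (HN' (Nat.max N N') ltac:(lia)).
  pose proof (Cmod_triangle_minus (fs n w) (fs (Nat.max N N') w) (g w)). lra.
Qed.

Lemma holo_uniform_limit (fs : nat -> C -> C) (a b c d : R) : a <= b -> c <= d ->
  (forall n, holo a b c d (fs n)) ->
  (forall e, 0 < e -> exists N, forall n m, (N <= n)%nat -> (N <= m)%nat ->
    forall w, inbox a b c d w -> Cmod (fs n w - fs m w) <= e) ->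
  exists g, holo a b c d g /\ forall e, 0 < e -> exists N, forall n, (N <= n)%nat ->
    forall w, inbox a b c d w -> Cmod (fs n w - g w) <= e.
Proof.
  intros Hab Hcd Hf H. destruct (uniform_cauchy_limit _ _ H) as [g Hg].
  (* Off the box [g] is an arbitrary choice; only its values on the box are kept. *)
  set (h := fun w => g (clamp a b c d w)).
  assert (Hh : forall e, 0 < e -> exists N, forall n, (N <= n)%nat ->
    forall w, inbox a b c d w -> Cmod (fs n w - h w) <= e).
  { intros e He. destruct (Hg e He) as [N HN]. exists N. intros n Hn w Hw. unfold h.
    rewrite clamp_id by assumption. auto. }
  assert (Ch : forall w, cont h w).
  { intros w e He. destruct (Hg (e / 4) ltac:(lra)) as [N HN].
    assert (Cf : cont (fun w => fs N (clamp a b c d w)) w).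
    { apply cont_comp; [now apply clamp_cont | apply Hf]. }
    destruct (Cf (e / 4) ltac:(lra)) as [r [Hr Hd]]. exists r. split; [assumption|]. intros v Hv.
    specialize (Hd v Hv). unfold h.
    pose proof (HN N (Nat.le_refl N) _ (clamp_in a b c d v Hab Hcd)) as Q1.
    pose proof (HN N (Nat.le_refl N) _ (clamp_in a b c d w Hab Hcd)) as Q2.
    rewrite Cmod_sym in Q1.
    set (p := clamp a b c d v) in *. set (q := clamp a b c d w) in *.
    pose proof (Cmod_triangle_minus (g p) (fs N p) (g q)).
    pose proof (Cmod_triangle_minus (fs N p) (fs N q) (g q)). lra. }
  exists h. split; [|assumption]. split; [assumption|]. intros w Hw.
  apply (uniform_limit_cdiff h a b c d w Ch); [|assumption].
  intros e He. destruct (Hh e He) as [N HN]. exists (fs N). split; [apply Hf|]. split; [apply Hf|].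
  now apply HN.
Qed.

(* [full = false] is the one-sided (upper) problem, [full = true] the two-sided one. *)
Definition lo (full : bool) (r : R) : R := if full then - r else 0.

Definition box_ext (full : bool) (z r : R) (u : R -> C) : Prop :=
  exists f, holo (z - r) (z + r) (lo full r) r f /\ forall x, Rabs (x - z) <= r -> f (x, 0) = u x.

Definition box_approx (full : bool) (z r M : R) (u : R -> C) : Prop :=
  forall e, 0 < e -> exists f, holo (z - r) (z + r) (lo full r) r f /\
    (forall w, inbox (z - r) (z + r) (lo full r) r w -> Cmod (f w) <= M) /\
    forall x, Rabs (x - z) <= r -> Cmod (f (x, 0) - u x) <= e.

(** In the two-sided case the lower half is reflected to the upper one: [Cconj (f (Cconj v))] is
    again holomorphic and has the same moduli on the axis. *)
Lemma two_constants_full (full : bool) (z r M eta : R) : 0 < r -> 0 < M -> 0 < eta ->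
  exists e, 0 < e /\ forall f, holo (z - r) (z + r) (lo full r) r f ->
    (forall w, inbox (z - r) (z + r) (lo full r) r w -> Cmod (f w) <= M) ->
    (forall x, Rabs (x - z) <= r -> Cmod (f (x, 0)) <= e) ->
    forall w, inbox (z - r / 16) (z + r / 16) (lo full (r / 16)) (r / 16) w -> Cmod (f w) <= eta.
Proof.
  intros Hr HM He. destruct (two_constants z r M eta Hr HM He) as [e [Pe H]].
  exists e. split; [assumption|]. intros f Hf Mf Ef w Hw.
  assert (Hlo : lo full r <= 0) by (unfold lo; destruct full; lra).
  destruct (Rle_dec 0 (snd w)) as [Pw|Nw].
  - apply H; auto.
    + revert Hf. apply holo_sub; lra.
    + intros v Hv. apply Mf. revert Hv. apply inbox_sub; lra.
    + unfold inbox in *. lra.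
  - rewrite <- Cmod_conj, <- (Cconj_conj w).
    destruct full; [|unfold inbox, lo in Hw; lra]. unfold lo in *.
    apply (H (fun v => Cconj (f (Cconj v)))).
    + apply holo_conj in Hf. revert Hf. apply holo_sub; lra.
    + intros v Hv. rewrite Cmod_conj. apply Mf. unfold inbox in *; simpl. lra.
    + intros x Hx. rewrite Cmod_conj. unfold Cconj; simpl. rewrite Ropp_0. auto.
    + unfold inbox in *; simpl. lra.
Qed.

Theorem box_approx_ext (full : bool) (z r M : R) (u : R -> C) : 0 < r -> 0 < M ->
  box_approx full z r M u -> box_ext full z (r / 16) u.
Proof.
  intros Hr HM H.
  assert (Pinv : forall n, 0 < / (INR n + 1)) by (intros n; apply Rinv_0_lt_compat; pose proof (pos_INR n); lra).
  destruct (choice _ (fun n => H _ (Pinv n))) as [fs Hfs].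
  assert (Small : forall e, 0 < e -> exists N, forall n, (N <= n)%nat -> / (INR n + 1) < e).
  { intros e He. destruct (archimed_cor1 e He) as [N [HN HN0]]. exists N. intros n Hn.
    apply Rle_lt_trans with (/ INR N); [|assumption]. apply Rinv_le_contravar; [now apply lt_0_INR|].
    apply le_INR in Hn. lra. }
  assert (Hlo : lo full r <= lo full (r / 16) <= 0) by (unfold lo; destruct full; lra).
  destruct (holo_uniform_limit fs (z - r / 16) (z + r / 16) (lo full (r / 16)) (r / 16)) as [g [Hg Eg]]; try lra.
  - intros n. apply (holo_sub _ _ _ _ (z - r) (z + r) (lo full r) r); try lra. apply Hfs.
  (* Two approximants differ by at most [2 * M] on the box and by little on the interval, hence by
     little on the smaller box. *)
  - intros e He. destruct (two_constants_full full z r (2 * M) e Hr ltac:(lra) He) as [e' [Pe' H']].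
    destruct (Small (e' / 2) ltac:(lra)) as [N HN]. exists N. intros n m Hn Hm w Hw.
    destruct (Hfs n) as [A1 [A2 A3]]. destruct (Hfs m) as [B1 [B2 B3]].
    apply (H' (fun w => fs n w - fs m w)%C); auto.
    + now apply holo_minus.
    + intros v Hv. eapply Rle_trans; [apply Cmod_triangle|]. rewrite Cmod_opp.
      specialize (A2 v Hv). specialize (B2 v Hv). lra.
    + intros x Hx. pose proof (Cmod_triangle_minus (fs n (x, 0)) (u x) (fs m (x, 0))) as T.
      rewrite (Cmod_sym (u x)) in T. specialize (A3 x Hx). specialize (B3 x Hx).
      pose proof (HN n Hn). pose proof (HN m Hm). lra.
  - exists g. split; [assumption|]. intros x Hx. apply Ceq_minus, Cmod_eq_0.
    apply Rle_antisym; [|apply Cmod_ge_0].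
    apply Rnot_lt_le. intros P. set (e := Cmod (g (x, 0) - u x)) in *.
    destruct (Eg (e / 4) ltac:(lra)) as [N1 H1]. destruct (Small (e / 4) ltac:(lra)) as [N2 H2].
    set (n := Nat.max N1 N2).
    assert (I : inbox (z - r / 16) (z + r / 16) (lo full (r / 16)) (r / 16) (x, 0)).
    { apply Rabs_le_between in Hx. unfold inbox; simpl. lra. }
    pose proof (H1 n ltac:(unfold n; lia) _ I) as Q1. pose proof (H2 n ltac:(unfold n; lia)) as Q2.
    destruct (Hfs n) as [_ [_ A3]]. specialize (A3 x ltac:(lra)).
    rewrite Cmod_sym in Q1.
    pose proof (Cmod_triangle_minus (g (x, 0)) (fs n (x, 0)) (u x)) as T. fold e in T. lra.
Qed.

(** * A lacunary series *)

Definition cexp (z : C) : C := (exp (fst z) * cos (snd z), exp (fst z) * sin (snd z)).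

Lemma cexp_plus (z w : C) : cexp (z + w) = (cexp z * cexp w)%C.
Proof.
  unfold cexp, Cmult; simpl. rewrite exp_plus, cos_plus, sin_plus. f_equal; ring.
Qed.

Lemma Cmod_cexp (z : C) : Cmod (cexp z) = exp (fst z).
Proof.
  unfold Cmod, cexp; simpl fst; simpl snd.
  replace ((exp (fst z) * cos (snd z)) ^ 2 + (exp (fst z) * sin (snd z)) ^ 2)
    with (exp (fst z) ^ 2 * ((sin (snd z))² + (cos (snd z))²)) by (unfold Rsqr; ring).
  rewrite sin2_cos2, Rmult_1_r. apply sqrt_pow2. left. apply exp_pos.
Qed.

Lemma linear_approx (f : R -> R) (l e : R) : derivable_pt_lim f 0 l -> 0 < e ->
  exists d, 0 < d /\ forall h, Rabs h < d -> Rabs (f h - f 0 - l * h) <= e * Rabs h.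
Proof.
  intros D He. destruct (D e He) as [[d Hd] H]; simpl in H. exists d. split; [assumption|].
  intros h Hh. destruct (Req_dec h 0) as [->|n].
  - replace (f 0 - f 0 - l * 0) with 0 by ring. rewrite !Rabs_R0. lra.
  - specialize (H h n Hh). rewrite Rplus_0_l in H.
    replace (f h - f 0 - l * h) with (((f h - f 0) / h - l) * h) by (field; assumption).
    rewrite Rabs_mult. apply Rmult_le_compat_r; [apply Rabs_pos | lra].
Qed.

Lemma cdiff_cexp_0 : cdiff cexp (RtoC 0).
Proof.
  (* The errors below add up to at most [6 * k * Cmod w], so [k <= e / 16] is ample. [k <= 1] keeps
     [exp x] below 2, and the radius [k / 2] makes [exp x - 1] at most [k] in absolute value. *)
  apply cdiff_iff. exists (RtoC 1). intros e He. set (k := Rmin 1 (e / 16)).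
  assert (Hk : 0 < k) by (apply Rmin_glb_lt; lra).
  assert (k <= 1) by apply Rmin_l. assert (k <= e / 16) by apply Rmin_r.
  destruct (linear_approx exp 1 k) as [d1 [Hd1 A1]]; [rewrite <- exp_0; apply derivable_pt_lim_exp | assumption |].
  destruct (linear_approx cos 0 k) as [d2 [Hd2 A2]].
  { pose proof (derivable_pt_lim_cos 0) as D. rewrite sin_0, Ropp_0 in D. exact D. } { assumption. }
  destruct (linear_approx sin 1 k) as [d3 [Hd3 A3]]; [rewrite <- cos_0; apply derivable_pt_lim_sin | assumption |].
  exists (Rmin (Rmin d1 d2) (Rmin d3 (k / 2))). split; [repeat apply Rmin_glb_lt; lra|].
  intros w Hw. replace (w - RtoC 0)%C with w in * by ring.
  destruct w as [x y].
  pose proof (fst_le_Cmod (x, y)) as F. pose proof (snd_le_Cmod (x, y)) as G. simpl fst in F; simpl snd in G.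
  pose proof (Rmin_l (Rmin d1 d2) (Rmin d3 (k / 2))). pose proof (Rmin_r (Rmin d1 d2) (Rmin d3 (k / 2))).
  pose proof (Rmin_l d1 d2). pose proof (Rmin_r d1 d2).
  pose proof (Rmin_l d3 (k / 2)). pose proof (Rmin_r d3 (k / 2)).
  specialize (A1 x ltac:(lra)). specialize (A2 y ltac:(lra)). specialize (A3 y ltac:(lra)).
  rewrite exp_0 in A1. rewrite cos_0 in A2. rewrite sin_0 in A3.
  assert (Ex : Rabs (exp x - 1) <= 2 * Rabs x).
  { replace (exp x - 1) with ((exp x - 1 - 1 * x) + x) by ring.
    eapply Rle_trans; [apply Rabs_triang|]. pose proof (Rabs_pos x). nra. }
  assert (Ex3 : Rabs (exp x) <= 2).
  { replace (exp x) with ((exp x - 1) + 1) by ring.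
    eapply Rle_trans; [apply Rabs_triang|]. rewrite Rabs_R1. lra. }
  eapply Rle_trans; [apply Cmod_le_sum|].
  unfold cexp, RtoC, Cminus, Cplus, Copp, Cmult; simpl fst; simpl snd.
  rewrite exp_0, cos_0, sin_0.
  replace (exp x * cos y + - (1 * 1) + - (1 * x - 0 * y))
    with ((exp x - 1 - 1 * x) + exp x * (cos y - 1 - 0 * y)) by ring.
  replace (exp x * sin y + - (1 * 0) + - (1 * y + 0 * x))
    with (exp x * (sin y - 0 - 1 * y) + (exp x - 1) * y) by ring.
  eapply Rle_trans; [apply Rplus_le_compat; apply Rabs_triang|]. rewrite !Rabs_mult.
  pose proof (Rabs_pos x). pose proof (Rabs_pos y). pose proof (Rabs_pos (exp x)). pose proof (Rabs_pos (exp x - 1)).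
  pose proof (Rabs_pos (cos y - 1 - 0 * y)). pose proof (Rabs_pos (sin y - 0 - 1 * y)).
  assert (B1 : Rabs (exp x) * Rabs (cos y - 1 - 0 * y) <= 2 * (k * Rabs y)) by (apply Rmult_le_compat; assumption).
  assert (B2 : Rabs (exp x) * Rabs (sin y - 0 - 1 * y) <= 2 * (k * Rabs y)) by (apply Rmult_le_compat; assumption).
  assert (B3 : Rabs (exp x - 1) * Rabs y <= k * Rabs y) by (apply Rmult_le_compat_r; lra).
  set (N := Cmod (x, y)) in *.
  assert (k * Rabs x <= k * N) by nra. assert (k * Rabs y <= k * N) by nra.
  assert (0 <= N) by apply Cmod_ge_0. assert (k * N <= e / 16 * N) by nra. lra.
Qed.

Lemma cdiff_cexp (z : C) : cdiff cexp z.
Proof.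
  apply (cdiff_local (fun w => cexp z * cexp (w - z))%C _ _ 1 Rlt_0_1).
  - intros w _. rewrite <- cexp_plus. f_equal. ring.
  - apply cdiff_scal. apply (cdiff_comp cexp (fun w => (w - z)%C)).
    + apply cdiff_minus; [apply cdiff_id | apply cdiff_const].
    + replace (z - z)%C with (RtoC 0) by ring. apply cdiff_cexp_0.
Qed.

(** The entire function [exp (i k z)]. Its modulus [exp (- (k * y))] decays upwards for [k > 0],
    which is the gain from moving the contour into the upper half plane. *)
Definition cwave (k : R) (z : C) : C := cexp (Ci * RtoC k * z).

Lemma cwave_eq (k : R) (x y : R) :
  cwave k (x, y) = (exp (- (k * y)) * cos (k * x), exp (- (k * y)) * sin (k * x)).
Proof.
  unfold cwave, cexp, Ci, RtoC, Cmult; simpl. f_equal; f_equal; f_equal; ring.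
Qed.

Lemma cdiff_cwave (k : R) (z : C) : cdiff (cwave k) z.
Proof.
  apply (cdiff_comp cexp (fun w => Ci * RtoC k * w)%C); [apply cdiff_scal, cdiff_id | apply cdiff_cexp].
Qed.

Definition ccos (k : R) (z : C) : C := (RtoC (1 / 2) * (cwave k z + cwave (- k) z))%C.

Lemma ccos_real (k x : R) : ccos k (x, 0) = RtoC (cos (k * x)).
Proof.
  unfold ccos. rewrite !cwave_eq. rewrite !Rmult_0_r, Ropp_0, exp_0.
  replace (- k * x) with (- (k * x)) by ring. rewrite cos_neg, sin_neg.
  unfold RtoC, Cplus, Cmult; simpl. f_equal; field.
Qed.

Lemma cdiff_ccos (k : R) (z : C) : cdiff (ccos k) z.
Proof. apply cdiff_scal. apply cdiff_plus; apply cdiff_cwave. Qed.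

Definition freq (n : nat) : R := 2 ^ n.
(** The weights decay faster than every power of [freq n], which makes the series smooth, but slower
    than [exp (- (freq n * h))] for every [h > 0], the decay that an extension to height [h] would
    impose. *)
Definition wt (n : nat) : R := exp (- INR n ^ 2).

Lemma freq_pos (n : nat) : 0 < freq n.
Proof. apply pow_lt. lra. Qed.

Lemma wt_pos (n : nat) : 0 < wt n.
Proof. apply exp_pos. Qed.

Lemma exp_INR (n : nat) : exp (INR n) = exp 1 ^ n.
Proof.
  induction n as [|n IH]; [apply exp_0|]. rewrite S_INR, exp_plus, IH. simpl. ring.
Qed.

Lemma exp_mono (x y : R) : x <= y -> exp x <= exp y.
Proof. intros [H|H]; [left; now apply exp_increasing | right; now rewrite H]. Qed.

Lemma exp_1_ge_2 : 2 <= exp 1.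
Proof. pose proof (exp_ineq1_le 1). lra. Qed.

(** With [freq n ^ l <= exp (n l)], completing the square gives [n (l + 1) <= n^2 + (l + 1)^2]. The
    one [n] to spare yields the geometric factor. *)
Lemma wt_freq_bound (l n : nat) :
  wt n * freq n ^ l <= exp (INR (S l) ^ 2) * (/ exp 1) ^ n.
Proof.
  assert (freq n ^ l <= exp (INR n * INR l)).
  { unfold freq. rewrite <- pow_mult, <- mult_INR, exp_INR. apply pow_incr.
    pose proof exp_1_ge_2. lra. }
  rewrite pow_inv, <- exp_INR, <- exp_Ropp, <- exp_plus. unfold wt.
  apply Rle_trans with (exp (- INR n ^ 2) * exp (INR n * INR l)).
  - apply Rmult_le_compat_l; [left; apply exp_pos | assumption].
  - rewrite <- exp_plus. apply exp_mono. rewrite S_INR.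
    pose proof (pow2_ge_0 (INR n - (INR l + 1) / 2)). pose proof (pow2_ge_0 (INR l + 1)). nra.
Qed.

Lemma wt_freq_summable (l : nat) : ex_series (fun n => wt n * freq n ^ l).
Proof.
  apply (ex_series_le (V := R_CompleteNormedModule) _ (fun n => exp (INR (S l) ^ 2) * (/ exp 1) ^ n)).
  - intros n. change (Rabs (wt n * freq n ^ l) <= exp (INR (S l) ^ 2) * (/ exp 1) ^ n).
    rewrite Rabs_pos_eq; [apply wt_freq_bound|].
    apply Rmult_le_pos; [left; apply wt_pos | apply pow_le; left; apply freq_pos].
  - apply (ex_series_scal (V := R_NormedModule) (exp (INR (S l) ^ 2)) (fun n => (/ exp 1) ^ n)). apply ex_series_geom.
    pose proof exp_1_ge_2. rewrite Rabs_pos_eq by (left; apply Rinv_0_lt_compat; lra).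
    pose proof (Rinv_le_contravar 2 (exp 1) ltac:(lra) ltac:(lra)). lra.
Qed.

Lemma sin_lip (x y : R) : Rabs (sin x - sin y) <= Rabs (x - y).
Proof.
  destruct (MVT_gen sin y x cos) as [c [_ E]].
  - intros t _. auto_derive; [trivial | ring].
  - intros t _. apply continuity_sin.
  - rewrite E, Rabs_mult. rewrite <- (Rmult_1_l (Rabs (x - y))) at 2.
    apply Rmult_le_compat_r; [apply Rabs_pos|]. apply Rabs_le, COS_bound.
Qed.

(** The mean value theorem for [cos (a + s) + s sin a], whose derivative [sin a - sin (a + s)] is at
    most [|s|]. The derivative of the cosine appears as a shift by [PI / 2] to match [lac_term]. *)
Lemma cos_taylor (a t : R) : Rabs (cos (a + t) - cos a - t * cos (a + PI / 2)) <= t ^ 2.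
Proof.
  replace (cos (a + PI / 2)) with (- sin a) by (rewrite cos_plus, cos_PI2, sin_PI2; ring).
  assert (D : forall s, is_derive (fun s => cos (a + s) + s * sin a) s (sin a - sin (a + s))).
  { intros s. auto_derive; [trivial | ring]. }
  destruct (MVT_gen (fun s => cos (a + s) + s * sin a) 0 t (fun s => sin a - sin (a + s))) as [c [Hc E]].
  - intros s _. apply D.
  - intros s _. apply derivable_continuous_pt.
    exists (sin a - sin (a + s)). apply is_derive_Reals, D.
  - rewrite Rplus_0_r in E.
    replace (cos (a + t) - cos a - t * - sin a) with (cos (a + t) + t * sin a - (cos a + 0 * sin a)) by ring.
    rewrite E, Rminus_0_r, Rabs_mult.
    replace (t ^ 2) with (Rabs t * Rabs t) by (rewrite <- pow2_abs; ring).
    apply Rmult_le_compat_r; [apply Rabs_pos|]. eapply Rle_trans; [apply sin_lip|].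
    replace (a - (a + c)) with (- c) by ring. rewrite Rabs_Ropp.
    revert Hc. unfold Rmin, Rmax. destruct Rle_dec; intros; unfold Rabs; repeat destruct Rcase_abs; lra.
Qed.

(** The [l]-th derivative of [wt n * cos (freq n * x)]: each differentiation multiplies by [freq n]
    and shifts the phase by [PI / 2], so all orders share one formula. *)
Definition lac_term (l : nat) (x : R) (n : nat) : R :=
  wt n * freq n ^ l * cos (freq n * x + INR l * (PI / 2)).

Definition lac (l : nat) (x : R) : R := Series (lac_term l x).
Definition lac_sup (l : nat) : R := Series (fun n => wt n * freq n ^ l).

Lemma wt_freq_nonneg (l n : nat) : 0 <= wt n * freq n ^ l.
Proof. apply Rmult_le_pos; [left; apply wt_pos | apply pow_le; left; apply freq_pos]. Qed.

Lemma lac_term_bound (l : nat) (x : R) (n : nat) : Rabs (lac_term l x n) <= wt n * freq n ^ l.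
Proof.
  unfold lac_term. rewrite Rabs_mult, (Rabs_pos_eq (wt n * freq n ^ l)) by apply wt_freq_nonneg.
  rewrite <- (Rmult_1_r (wt n * freq n ^ l)) at 2.
  apply Rmult_le_compat_l; [apply wt_freq_nonneg | apply Rabs_le, COS_bound].
Qed.

Lemma ex_series_dom (a b : nat -> R) : (forall n, Rabs (a n) <= b n) -> ex_series b -> ex_series a.
Proof. intros H Hb. now apply (ex_series_le (V := R_CompleteNormedModule) a b). Qed.

Lemma Series_dom (a b : nat -> R) : (forall n, Rabs (a n) <= b n) -> ex_series b ->
  Rabs (Series a) <= Series b.
Proof.
  intros H Hb. eapply Rle_trans; [apply Series_Rabs|].
  - apply (ex_series_dom _ b); [|assumption]. intros n. now rewrite Rabs_Rabsolu.
  - apply Series_le; [|assumption]. intros n. split; [apply Rabs_pos | apply H].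
Qed.

Lemma lac_summable (l : nat) (x : R) : ex_series (lac_term l x).
Proof. apply (ex_series_dom _ _ (lac_term_bound l x)), wt_freq_summable. Qed.

Lemma lac_bound (l : nat) (x : R) : Rabs (lac l x) <= lac_sup l.
Proof. apply (Series_dom _ _ (lac_term_bound l x)), wt_freq_summable. Qed.

Lemma lac_sup_mono (l m : nat) : (l <= m)%nat -> lac_sup l <= lac_sup m.
Proof.
  intros H. apply Series_le; [|apply wt_freq_summable]. intros n. split; [apply wt_freq_nonneg|].
  apply Rmult_le_compat_l; [left; apply wt_pos|]. apply Rle_pow; [|assumption].
  unfold freq. apply pow_R1_Rle. lra.
Qed.

Lemma lac_sup_nonneg (l : nat) : 0 <= lac_sup l.
Proof. eapply Rle_trans; [apply Rabs_pos | apply (lac_bound l 0)]. Qed.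

(** The quadratic remainders of the cosines are summed term by term; this differentiates the series
    directly and costs two powers of [freq n], which the weights can afford. *)
Lemma lac_taylor (l : nat) (x h : R) :
  Rabs (lac l (x + h) - lac l x - h * lac (S l) x) <= h ^ 2 * lac_sup (S (S l)).
Proof.
  unfold lac, lac_sup. rewrite <- !Series_scal_l.
  assert (S1 : ex_series (fun n => lac_term l (x + h) n - lac_term l x n)).
  { apply (ex_series_minus (V := R_NormedModule)); apply lac_summable. }
  assert (S2 : ex_series (fun n => h * lac_term (S l) x n)).
  { apply (ex_series_scal (V := R_NormedModule) h), lac_summable. }
  rewrite <- (Series_minus (lac_term l (x + h)) (lac_term l x)) by apply lac_summable.
  rewrite <- Series_minus by assumption.
  apply Series_dom.
  - intros n. unfold lac_term.
    replace (wt n * freq n ^ l * cos (freq n * (x + h) + INR l * (PI / 2))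
             - wt n * freq n ^ l * cos (freq n * x + INR l * (PI / 2))
             - h * (wt n * freq n ^ S l * cos (freq n * x + INR (S l) * (PI / 2))))
      with (wt n * freq n ^ l *
             (cos ((freq n * x + INR l * (PI / 2)) + freq n * h)
              - cos (freq n * x + INR l * (PI / 2))
              - (freq n * h) * cos ((freq n * x + INR l * (PI / 2)) + PI / 2))).
    + rewrite Rabs_mult, (Rabs_pos_eq (wt n * freq n ^ l)) by apply wt_freq_nonneg.
      replace (h ^ 2 * (wt n * freq n ^ S (S l))) with (wt n * freq n ^ l * (freq n * h) ^ 2) by (simpl; ring).
      apply Rmult_le_compat_l; [apply wt_freq_nonneg | apply cos_taylor].
    + rewrite S_INR.
      replace (freq n * x + INR l * (PI / 2) + freq n * h) with (freq n * (x + h) + INR l * (PI / 2)) by ring.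
      replace (freq n * x + INR l * (PI / 2) + PI / 2) with (freq n * x + (INR l + 1) * (PI / 2)) by ring.
      simpl pow. ring.
  - apply (ex_series_scal (V := R_NormedModule) (h ^ 2)), wt_freq_summable.
Qed.

Lemma lac_derive (l : nat) (x : R) : derivable_pt_lim (lac l) x (lac (S l) x).
Proof.
  intros e He. pose proof (lac_sup_nonneg (S (S l))) as P.
  assert (Hd : 0 < e / (lac_sup (S (S l)) + 1)) by (apply Rdiv_lt_0_compat; lra).
  exists (mkposreal _ Hd). intros h n Hh. simpl in Hh.
  replace ((lac l (x + h) - lac l x) / h - lac (S l) x)
    with ((lac l (x + h) - lac l x - h * lac (S l) x) / h) by (field; assumption).
  unfold Rdiv. rewrite Rabs_mult, Rabs_inv by assumption. pose proof (Rabs_pos_lt h n).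
  apply Rmult_lt_reg_r with (Rabs h); [assumption|].
  rewrite Rmult_assoc, Rinv_l, Rmult_1_r by lra.
  eapply Rle_lt_trans; [apply lac_taylor|]. rewrite <- pow2_abs.
  assert (Rabs h * (lac_sup (S (S l)) + 1) < e).
  { apply Rlt_le_trans with (e / (lac_sup (S (S l)) + 1) * (lac_sup (S (S l)) + 1));
      [apply Rmult_lt_compat_r; lra|]. right. field. lra. }
  nra.
Qed.

Lemma lac_continuous (l : nat) : continuity (lac l).
Proof. intros x. apply derivable_continuous_pt. eexists. apply lac_derive. Qed.

(** * The lacunary series does not extend *)

Definition lac_tail (p : nat) (x : R) : R := Series (fun i => lac_term 0 x (p + i)).

Fixpoint lac_part (p : nat) (x : R) : R :=
  match p with O => 0 | S p => lac_part p x + wt p * cos (freq p * x) end.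

Fixpoint lac_part_ext (p : nat) (w : C) : C :=
  match p with O => RtoC 0 | S p => (lac_part_ext p w + RtoC (wt p) * ccos (freq p) w)%C end.

Lemma lac_part_ext_real (p : nat) (x : R) : lac_part_ext p (x, 0) = RtoC (lac_part p x).
Proof.
  induction p as [|p IH]; simpl; [reflexivity|]. now rewrite IH, ccos_real, RtoC_plus, RtoC_mult.
Qed.

Lemma cdiff_lac_part_ext (p : nat) (w : C) : cdiff (lac_part_ext p) w.
Proof.
  induction p as [|p IH]; simpl; [apply cdiff_const|].
  apply cdiff_plus; [assumption|]. apply cdiff_scal, cdiff_ccos.
Qed.

Lemma lac_term_0 (x : R) (n : nat) : lac_term 0 x n = wt n * cos (freq n * x).
Proof. unfold lac_term. simpl. rewrite Rmult_0_l, Rplus_0_r. ring. Qed.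

Lemma lac_tail_summable (p : nat) (x : R) : ex_series (fun i => lac_term 0 x (p + i)).
Proof. apply (ex_series_incr_n (V := R_NormedModule)), lac_summable. Qed.

Lemma lac_tail_S (p : nat) (x : R) : lac_tail p x = wt p * cos (freq p * x) + lac_tail (S p) x.
Proof.
  unfold lac_tail. rewrite Series_incr_1 by apply lac_tail_summable.
  rewrite Nat.add_0_r, lac_term_0. f_equal. apply Series_ext. intros n. f_equal. lia.
Qed.

Lemma lac_split (p : nat) (x : R) : lac 0 x = lac_part p x + lac_tail p x.
Proof.
  induction p as [|p IH]; simpl; [unfold lac, lac_tail; simpl; now rewrite Rplus_0_l|].
  rewrite IH, lac_tail_S. ring.
Qed.

Lemma exp_3_ge_8 : 8 <= exp 3.
Proof.
  replace 3 with (INR 3) by (simpl; ring). rewrite exp_INR.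
  replace 8 with (2 ^ 3) by ring. apply pow_incr. pose proof exp_1_ge_2. lra.
Qed.

(** Consecutive weights have ratio [exp (- (2 n + 1))], at most [exp (- 3) <= 1/8] once [n >= 1]. *)
Lemma wt_decay (n i : nat) : (1 <= n)%nat -> wt (n + i) <= wt n * (/ 8) ^ i.
Proof.
  intros Hn. induction i as [|i IH]; [rewrite Nat.add_0_r; simpl; lra|].
  rewrite Nat.add_succ_r.
  apply Rle_trans with (wt (n + i) * / 8).
  - unfold wt. pose proof exp_3_ge_8.
    apply Rle_trans with (exp (- INR (n + i) ^ 2) * exp (- (3))).
    + rewrite <- exp_plus. apply exp_mono. rewrite S_INR.
      assert (1 <= INR (n + i)) by (apply (le_INR 1); lia). nra.
    + apply Rmult_le_compat_l; [left; apply exp_pos|]. rewrite exp_Ropp. apply Rinv_le_contravar; lra.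
  - simpl. lra.
Qed.

Lemma lac_tail_small (n : nat) (x : R) : (1 <= n)%nat -> Rabs (lac_tail (S n) x) <= wt n / 4.
Proof.
  intros Hn. assert (G : is_series (fun i => (/ 8) ^ i) (/ (1 - / 8))).
  { apply is_series_geom. rewrite Rabs_pos_eq; lra. }
  (* The geometric series sums to [wt n / 7]. *)
  apply Rle_trans with (Series (fun i => wt n * / 8 * (/ 8) ^ i)).
  - apply Series_dom.
    + intros i. rewrite lac_term_0, Rabs_mult, (Rabs_pos_eq (wt _)) by (left; apply wt_pos).

      apply Rle_trans with (wt (S n + i) * 1).
      * apply Rmult_le_compat_l; [left; apply wt_pos | apply Rabs_le, COS_bound].
      * rewrite Rmult_1_r. replace (S n + i)%nat with (n + S i)%nat by lia.
        eapply Rle_trans; [now apply wt_decay|]. simpl. lra.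
    + apply (ex_series_scal (V := R_NormedModule) (wt n * / 8) (fun i => (/ 8) ^ i)). now exists (/ (1 - / 8)).
  - rewrite (Series_scal_l (wt n * / 8) (fun i => (/ 8) ^ i)), (is_series_unique _ _ G). pose proof (wt_pos n). lra.
Qed.

(** * Fourier coefficients of the tails over one period *)

Lemma cos_period_Z (x : R) (k : Z) : cos (x + 2 * IZR k * PI) = cos x.
Proof.
  destruct k as [|p|p].
  - f_equal. ring.
  - rewrite <- (cos_period x (Pos.to_nat p)). f_equal. rewrite INR_IZR_INZ, Znat.positive_nat_Z. ring.
  - rewrite <- (cos_period (x + 2 * IZR (Z.neg p) * PI) (Pos.to_nat p)). f_equal.
    rewrite INR_IZR_INZ, Znat.positive_nat_Z. rewrite <- Pos2Z.opp_pos, opp_IZR. ring.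
Qed.

Lemma sin_period_Z (x : R) (k : Z) : sin (x + 2 * IZR k * PI) = sin x.
Proof.
  rewrite !sin_cos. replace (PI / 2 + (x + 2 * IZR k * PI)) with (PI / 2 + x + 2 * IZR k * PI) by ring.
  now rewrite cos_period_Z.
Qed.

Definition period (m : nat) : R := 2 * PI / 2 ^ m.

Lemma period_pos (m : nat) : 0 < period m.
Proof. apply Rdiv_lt_0_compat; [pose proof PI_RGT_0; lra | apply pow_lt; lra]. Qed.

Lemma freq_period (m n : nat) : (m <= n)%nat -> freq n * period m = 2 * IZR (2 ^ Z.of_nat (n - m)) * PI.
Proof.
  intros H. unfold freq, period. replace n with (m + (n - m))%nat at 1 by lia.
  rewrite pow_add, <- pow_IZR. field. apply pow_nonzero. lra.
Qed.

Lemma int_cos_period (k z l : R) (N : Z) : k <> 0 -> k * l = 2 * IZR N * PI ->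
  is_RInt (fun x => cos (k * x)) z (z + l) 0.
Proof.
  intros Hk E.
  replace 0 with (minus (sin (k * (z + l)) / k) (sin (k * z) / k)).
  - apply (is_RInt_derive (V := R_CompleteNormedModule) (fun x => sin (k * x) / k) (fun x => cos (k * x))).
    + intros x _. auto_derive; [trivial | field; assumption].
    + intros x _. apply (ex_derive_continuous (fun x => cos (k * x))). auto_derive. trivial.
  - rewrite Rmult_plus_distr_l, E, sin_period_Z. apply Rminus_diag.
Qed.

Lemma int_cos_cos (m j n : nat) (z : R) : (m <= j)%nat -> (j < n)%nat ->
  is_RInt (fun x => cos (freq j * x) * cos (freq n * x)) z (z + period m) 0.
Proof.
  intros Hj Hn.
  assert (L : freq j < freq n) by (apply Rlt_pow; [lra | assumption]).
  pose proof (freq_pos j).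
  apply (is_RInt_ext (V := R_NormedModule)
    (fun x => plus (scal (1 / 2) (cos ((freq n + freq j) * x))) (scal (1 / 2) (cos ((freq n - freq j) * x))))).
  - intros x _. unfold plus, scal; simpl; unfold mult; simpl.
    rewrite Rmult_plus_distr_r, Rmult_minus_distr_r, cos_plus, cos_minus. field.
  - replace 0 with (plus (scal (1 / 2) 0) (scal (1 / 2) 0)) by (unfold plus, scal; simpl; unfold mult; simpl; ring).
    apply (is_RInt_plus (V := R_NormedModule)); apply (is_RInt_scal (V := R_NormedModule)).
    + apply (int_cos_period _ _ _ (2 ^ Z.of_nat (n - m) + 2 ^ Z.of_nat (j - m))); [lra|].
      rewrite Rmult_plus_distr_r, !freq_period, plus_IZR by lia. ring.
    + apply (int_cos_period _ _ _ (2 ^ Z.of_nat (n - m) - 2 ^ Z.of_nat (j - m))); [lra|].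
      rewrite Rmult_minus_distr_r, !freq_period, minus_IZR by lia. ring.
Qed.

Lemma int_cos_sq (m n : nat) (z : R) : (m <= n)%nat ->
  is_RInt (fun x => cos (freq n * x) * cos (freq n * x)) z (z + period m) (period m / 2).
Proof.
  intros Hn. pose proof (freq_pos n).
  apply (is_RInt_ext (V := R_NormedModule)
    (fun x => plus (scal (1 / 2) (cos ((2 * freq n) * x))) (1 / 2))).
  - intros x _. unfold plus, scal; simpl; unfold mult; simpl.
    rewrite Rmult_assoc, cos_2a_cos. field.
  - replace (period m / 2) with (plus (scal (1 / 2) 0) (scal (z + period m - z) (1 / 2)))
      by (unfold plus, scal; simpl; unfold mult; simpl; field).
    apply (is_RInt_plus (V := R_NormedModule)).
    + apply (is_RInt_scal (V := R_NormedModule)).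
      apply (int_cos_period _ _ _ (2 * 2 ^ Z.of_nat (n - m))); [lra|].
      rewrite Rmult_assoc, freq_period, mult_IZR by assumption. ring.
    + apply (is_RInt_const (V := R_NormedModule)).
Qed.

Lemma int_part_cos (m p n : nat) (z : R) : (m <= p)%nat -> (p <= n)%nat ->
  is_RInt (fun x => (lac_part p x - lac_part m x) * cos (freq n * x)) z (z + period m) 0.
Proof.
  intros Hp. induction Hp as [|p Hp IH]; intros Hn.
  - apply (is_RInt_ext (V := R_NormedModule) (fun _ => 0)); [intros; rring|].
    refine (eq_ind _ (is_RInt (V := R_NormedModule) (fun _ => 0) z (z + period m))
      (is_RInt_const (V := R_NormedModule) z (z + period m) 0) 0 _).
    apply Rmult_0_r.
  - apply (is_RInt_ext (V := R_NormedModule)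
      (fun x => plus ((lac_part p x - lac_part m x) * cos (freq n * x))
                     (scal (wt p) (cos (freq p * x) * cos (freq n * x))))).
    + intros x _. unfold plus, scal; simpl; unfold mult; simpl. ring.
    + replace 0 with (plus 0 (scal (wt p) 0)) by (unfold plus, scal; simpl; unfold mult; simpl; ring).
      apply (is_RInt_plus (V := R_NormedModule)); [apply IH; lia|].
      apply (is_RInt_scal (V := R_NormedModule)), int_cos_cos; lia.
Qed.

Lemma lac_part_continuous (p : nat) (x : R) : continuous (lac_part p) x.
Proof.
  apply (ex_derive_continuous (lac_part p)). induction p as [|p IH]; simpl.
  - apply ex_derive_const.
  - apply (ex_derive_plus (V := R_NormedModule)); [assumption|]. auto_derive. trivial.
Qed.

Lemma lac_tail_continuous (p : nat) (x : R) : continuous (lac_tail p) x.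
Proof.
  apply (continuous_ext (fun x => minus (lac 0 x) (lac_part p x))).
  - intros y. rewrite (lac_split p y). unfold minus, plus, opp; simpl. ring.
  - apply (continuous_minus (V := R_NormedModule)); [|apply lac_part_continuous].
    apply continuity_pt_filterlim, lac_continuous.
Qed.

Lemma cos_continuous (k x : R) : continuous (fun x => cos (k * x)) x.
Proof. apply (ex_derive_continuous (fun x => cos (k * x))). auto_derive. trivial. Qed.

Lemma Rcontinuous_mult (f g : R -> R) (x : R) : continuous f x -> continuous g x ->
  continuous (fun x => f x * g x) x.
Proof. apply (continuous_mult (K := R_AbsRing)). Qed.

(** Terms of frequency below [freq n] are orthogonal to [cos (freq n * x)], and the [n]-th
    contributes [wt n * period m / 2]. The later terms are only estimated: together they take away
    at most half of that. *)
Lemma fourier_lower_bound (m n : nat) (z : R) : (m <= n)%nat -> (1 <= n)%nat ->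
  wt n / 4 * period m <= RInt (fun x => lac_tail m x * cos (freq n * x)) z (z + period m).
Proof.
  intros Hm Hn. pose proof (period_pos m) as Hp.
  set (rest := fun x => lac_tail (S n) x * cos (freq n * x)).
  assert (Cr : forall x, continuous rest x).
  { intros x. apply Rcontinuous_mult; [apply lac_tail_continuous | apply cos_continuous]. }
  assert (I : is_RInt (fun x => lac_tail m x * cos (freq n * x)) z (z + period m)
    (plus 0 (plus (scal (wt n) (period m / 2)) (RInt rest z (z + period m))))).
  { apply (is_RInt_ext (V := R_NormedModule)
      (fun x => plus ((lac_part n x - lac_part m x) * cos (freq n * x))
        (plus (scal (wt n) (cos (freq n * x) * cos (freq n * x))) (rest x)))).
    - intros x _. unfold plus, scal, rest; simpl; unfold mult; simpl.
      pose proof (lac_split m x) as E1. pose proof (lac_split n x) as E2. pose proof (lac_tail_S n x) as E3.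
      replace (lac_tail m x) with ((lac_part n x - lac_part m x) + (wt n * cos (freq n * x) + lac_tail (S n) x)) by lra.
      ring.
    - apply (is_RInt_plus (V := R_NormedModule)); [now apply int_part_cos|].
      apply (is_RInt_plus (V := R_NormedModule)).
      + apply (is_RInt_scal (V := R_NormedModule)). now apply int_cos_sq.
      + apply (RInt_correct (V := R_CompleteNormedModule)). now apply ex_RInt_cont. }
  rewrite (is_RInt_unique _ _ _ _ I).
  assert (B : Rabs (RInt rest z (z + period m)) <= wt n / 4 * period m).
  { replace (period m) with (z + period m - z) at 2 by ring. rewrite Rmult_comm.
    apply abs_RInt_le_const; [lra | now apply ex_RInt_cont|].
    intros x _. unfold rest. rewrite Rabs_mult, <- (Rmult_1_r (wt n / 4)).
    apply Rmult_le_compat; try apply Rabs_pos; [now apply lac_tail_small | apply Rabs_le, COS_bound]. }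
  apply Rabs_le_between in B. unfold plus, scal; simpl; unfold mult; simpl.
  unfold rest in *. lra.
Qed.

(** The factor 4 gives equality at [n = 4]; from there on the cube at most doubles at each step. *)
Lemma cube_le_pow2 (n : nat) : INR n ^ 3 <= 4 * 2 ^ n.
Proof.
  destruct (Nat.le_gt_cases 4 n) as [H|H].
  - induction H as [|n H IH]; [simpl; lra|].
    rewrite S_INR. apply le_INR in H. simpl in H. simpl pow in *.
    assert ((INR n + 1) ^ 3 <= 2 * INR n ^ 3).
    { assert (0 <= INR n - 4) by lra. set (t := INR n - 4) in *. replace (INR n) with (t + 4) by (unfold t; ring).
      ring_simplify. assert (0 <= t ^ 2) by nra. assert (0 <= t ^ 3) by (apply pow_le; lra). nra. }
    simpl in *. lra.
  - destruct n as [|[|[|[|n]]]]; simpl; try lra. lia.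
Qed.

(** Once [n h >= 8], the bound [2^n >= n^3 / 4] gives [2^n h >= 2 n^2 >= n^2 + n]. The factor
    [exp (- n)] gained over [wt n] absorbs [M], since [n >= |M|] and [n * exp (- n) < 1]. *)
Lemma wt_beats_exp (h M : R) (p : nat) : 0 < h ->
  exists n, (p <= n)%nat /\ M * exp (- (freq n * h)) < wt n.
Proof.
  intros Hh. destruct (INR_unbounded (8 / h)) as [n1 H1]. destruct (INR_unbounded (Rabs M)) as [n2 H2].
  set (n := (p + (n1 + n2) + 1)%nat). exists n. split; [unfold n; lia|].
  assert (N1 : 8 / h <= INR n) by (left; eapply Rlt_le_trans; [apply H1 | apply le_INR; unfold n; lia]).
  assert (N2 : Rabs M <= INR n) by (left; eapply Rlt_le_trans; [apply H2 | apply le_INR; unfold n; lia]).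
  assert (N3 : 1 <= INR n) by (apply (le_INR 1); unfold n; lia).
  assert (N4 : 8 <= INR n * h).
  { apply Rle_trans with (8 / h * h); [right; field; lra | apply Rmult_le_compat_r; lra]. }
  assert (F : INR n ^ 2 + INR n <= freq n * h).
  { pose proof (cube_le_pow2 n) as Q. fold (freq n) in Q.
    assert (INR n ^ 2 * 2 <= freq n * h).
    { apply Rle_trans with (INR n ^ 3 / 4 * h); [|apply Rmult_le_compat_r; lra].
      replace (INR n ^ 3 / 4 * h) with (INR n ^ 2 * (INR n * h / 4)) by field.
      apply Rmult_le_compat_l; [apply pow2_ge_0 | lra]. }
    nra. }
  apply Rle_lt_trans with (Rabs M * exp (- (freq n * h))).
  { apply Rmult_le_compat_r; [left; apply exp_pos | apply Rle_abs]. }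
  apply Rle_lt_trans with (INR n * exp (- (INR n ^ 2 + INR n))).
  { apply Rmult_le_compat; [apply Rabs_pos | left; apply exp_pos | assumption | apply exp_mono; lra]. }
  unfold wt. rewrite Ropp_plus_distr, exp_plus.
  assert (E : INR n * exp (- INR n) < 1).
  { rewrite exp_Ropp. apply Rmult_lt_reg_r with (exp (INR n)); [apply exp_pos|].
    rewrite Rmult_assoc, Rinv_l by (apply Rgt_not_eq, exp_pos).
    pose proof (exp_ineq1_le (INR n)). lra. }
  pose proof (exp_pos (- INR n ^ 2)). nra.
Qed.

(* Over one period the contributions of the vertical sides cancel. *)
Theorem lac_not_ext (z r : R) : 0 < r -> ~ box_ext false z r (fun x => RtoC (lac 0 x)).
Proof.
  intros Hr [f [Hf Ef]]. unfold lo in Hf.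
  (* The period has to be below [r / 2], so that the box of half-width [r / 2], shifted by it, stays
     in the domain. *)
  destruct (small_pow2 (2 * PI) (r / 2) ltac:(lra)) as [m Hm]. fold (period m) in Hm.
  pose proof (period_pos m) as Pl. set (l := period m) in *.
  set (g := fun w => (f w - lac_part_ext m w)%C).
  assert (Hg : holo (z - r) (z + r) 0 r g).
  { apply holo_minus; [assumption|]. apply entire_holo, cdiff_lac_part_ext. }
  assert (Eg : forall x, Rabs (x - z) <= r -> g (x, 0) = RtoC (lac_tail m x)).
  { intros x Hx. unfold g. rewrite Ef, lac_part_ext_real, <- RtoC_minus, (lac_split m x) by assumption.
    f_equal. ring. }
  destruct (box_bounded g (z - r) (z + r) 0 r ltac:(lra) ltac:(lra) (proj1 Hg)) as [M [HM Mg]].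
  assert (Tper : forall x, lac_tail m (x + l) = lac_tail m x).
  { intros x. unfold lac_tail. apply Series_ext. intros i. rewrite !lac_term_0. f_equal.
    unfold l. rewrite Rmult_plus_distr_l, freq_period, cos_period_Z by lia. reflexivity. }
  assert (Hsh : forall w, fst (w + RtoC l)%C = fst w + l /\ snd (w + RtoC l)%C = snd w).
  { intros w. simpl. split; ring. }
  set (mu := fun w => (g (w + RtoC l) - g w)%C).
  assert (Hmu : holo (z - r / 2) (z + r / 2) 0 (r / 2) mu).
  { apply holo_minus.
    - assert (D : forall w, cdiff (fun w => w + RtoC l)%C w).
      { intros w. apply cdiff_plus; [apply cdiff_id | apply cdiff_const]. }
      split; intros w.
      + apply (cont_comp g); [now apply cdiff_cont | apply Hg].
      + intros Hw. apply (cdiff_comp g); [apply D | apply Hg].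
        destruct (Hsh w) as [S1 S2]. unfold inobox in *. rewrite S1, S2. lra.
    - revert Hg. apply holo_sub; lra. }
  set (h := r / 2 / 16). assert (Hh : 0 < h) by (unfold h; lra).
  (* The difference [mu] vanishes on the axis, so the two-constants theorem with radius [r / 2]
     bounds it by every positive number up to height [h = r / 2 / 16]. *)
  assert (Zero : forall y, 0 <= y <= h -> g ((z + l)%R, y) = g (z, y)).
  { intros y Hy. apply Ceq_minus, Cmod_eq_0. apply Rle_antisym; [|apply Cmod_ge_0].
    apply Rnot_lt_le. intros P. set (q := Cmod _) in *.
    destruct (two_constants z (r / 2) (2 * M) (q / 2) ltac:(lra) ltac:(lra) ltac:(lra)) as [e [He H]].
    assert (Q : Cmod (mu (z, y)) <= q / 2).
    { apply H; [assumption| | |].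
      - intros w Hw. unfold mu. eapply Rle_trans; [apply Cmod_triangle|]. rewrite Cmod_opp.
        destruct (Hsh w) as [S1 S2].
        assert (Cmod (g (w + RtoC l)%C) <= M) by (apply Mg; unfold inbox in *; rewrite S1, S2; lra).
        assert (Cmod (g w) <= M) by (apply Mg; revert Hw; apply inbox_sub; lra). lra.
      - intros x Hx. apply Rabs_le_between in Hx. unfold mu.
        replace ((x, 0) + RtoC l)%C with ((x + l)%R, 0) by (unfold Cplus, RtoC; simpl; f_equal; ring).
        rewrite !Eg, Tper, Cmod_diag by (apply Rabs_le; lra). lra.
      - unfold inbox, h in *; simpl. lra. }
    unfold mu in Q. replace ((z, y) + RtoC l)%C with ((z + l)%R, y) in Q by (unfold Cplus, RtoC; simpl; f_equal; ring).
    fold q in Q. lra. }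
  (* The bottom side has modulus at least [wt n / 4 * l], the top side at most
     [M * exp (- (freq n * h)) * l]: hence the factor 4. Starting at [S m] gives both [m <= n] and
     [1 <= n]. *)
  destruct (wt_beats_exp h (4 * M) (S m) Hh) as [n [Hn Hwt]].
  set (G := fun w => (g w * cwave (freq n) w)%C).
  assert (HG : holo z (z + l) 0 h G).
  { apply holo_mult; [revert Hg; apply holo_sub; unfold h; lra|]. apply entire_holo, cdiff_cwave. }
  pose proof (goursat G z (z + l) 0 h ltac:(lra) ltac:(lra) (proj1 HG) (proj2 HG)) as I.
  assert (Sides : CInt (fun y => G ((z + l)%R, y)) 0 h = CInt (fun y => G (z, y)) 0 h).
  { apply CInt_ext; [lra|]. intros y Hy. unfold G. rewrite Zero by assumption. f_equal.
    rewrite !cwave_eq. unfold l. rewrite Rmult_plus_distr_l, freq_period, cos_period_Z, sin_period_Z by lia. reflexivity. }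
  unfold bint in I. rewrite Sides in I.
  replace (CInt (fun y => G (z, y)) 0 h - CInt (fun y => G (z, y)) 0 h)%C with (RtoC 0) in I by ring.
  rewrite Cmult_0_r, Cplus_0_r in I. apply Ceq_minus in I.
  assert (Up : Cmod (CInt (fun x => G (x, h)) z (z + l)) <= M * exp (- (freq n * h)) * (z + l - z)).
  { apply CInt_bound; [|lra|].
    - apply rcont_hor. intros x. apply HG.
    - intros x Hx. unfold G. rewrite Cmod_mult. apply Rmult_le_compat; try apply Cmod_ge_0.
      + apply Mg. unfold inbox, h; simpl. lra.
      + unfold cwave. rewrite Cmod_cexp. right. f_equal. simpl. ring. }
  rewrite <- I in Up.
  pose proof (fourier_lower_bound m n z ltac:(lia) ltac:(lia)) as Low. fold l in Low.
  assert (Re : fst (CInt (fun x => G (x, 0)) z (z + l)) = RInt (fun x => lac_tail m x * cos (freq n * x)) z (z + l)).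
  { unfold CInt; cbn [fst]. apply RInt_ext. rewrite Rmin_left, Rmax_right by lra. intros x Hx.
    unfold G. rewrite Eg, cwave_eq by (apply Rabs_le; lra).
    rewrite Rmult_0_r, Ropp_0, exp_0. unfold Cmult, RtoC; simpl.
    match goal with |- @eq _ ?x ?y => change (@eq R x y) end. ring. }
  pose proof (fst_le_Cmod (CInt (fun x => G (x, 0)) z (z + l))) as F. rewrite Re in F.
  pose proof (Rle_abs (RInt (fun x => lac_tail m x * cos (freq n * x)) z (z + l))) as A.
  assert (wt n / 4 * l <= M * exp (- (freq n * h)) * l).
  { replace (z + l - z) with l in Up by ring. eapply Rle_trans; [exact Low|].
    eapply Rle_trans; [exact A|]. eapply Rle_trans; [exact F | exact Up]. }
  apply Rmult_le_reg_r in H; [lra | assumption].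
Qed.

(** * The classes U2 to U5 *)

Lemma Cnorm_Cmod (z : C) : Cnorm z = Cmod z.
Proof. unfold Cnorm, Cmod. f_equal. ring. Qed.

Lemma Csub_Cminus (z w : C) : Csub z w = (z - w)%C.
Proof. reflexivity. Qed.

Lemma Cdiff_at_iff (f : C -> C) (z : C) : Cdiff_at f z <-> cdiff f z.
Proof.
  rewrite cdiff_iff. unfold Cdiff_at. split; intros [L H]; exists L; intros e He;
    destruct (H e He) as [d [Hd H']]; exists d; (split; [assumption|]).
  - intros w Hw. destruct (Ceq_dec w z) as [->|n].
    + replace (f z - f z - L * (z - z))%C with (RtoC 0) by ring. rewrite Cmod_diag, Cmod_0. lra.
    + specialize (H' (w - z)%C). rewrite !Cnorm_Cmod in H'.
      change (Cadd z (w - z)%C) with (z + (w - z))%C in H'. replace (z + (w - z))%C with w in H' by ring.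
      apply H'. split; [|assumption]. apply Cmod_gt_0. now apply Cminus_eq_contra.
  - intros h [_ Hh]. change Defs.C with C in h. rewrite !Cnorm_Cmod in *. specialize (H' (z + h)%C).
    replace (z + h - z)%C with h in H' by ring. exact (H' Hh).
Qed.

Lemma clamp_holo (f : C -> C) (a b c d : R) : a <= b -> c <= d ->
  (forall z, inbox a b c d z -> forall e, 0 < e -> exists r, 0 < r /\
    forall w, inbox a b c d w -> Cmod (w - z) < r -> Cmod (f w - f z) < e) ->
  (forall z, inobox a b c d z -> cdiff f z) ->
  holo a b c d (fun w => f (clamp a b c d w)).
Proof.
  intros Hab Hcd Hc Hd. split.
  - intros w e He. destruct (Hc _ (clamp_in a b c d w Hab Hcd) e He) as [r [Hr H]].
    destruct (clamp_cont a b c d w Hab Hcd r Hr) as [r' [Hr' H']]. exists r'. split; [assumption|].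
    intros v Hv. apply H; [now apply clamp_in | now apply H'].
  - intros w Hw. destruct (inobox_margin _ _ _ _ _ Hw) as [r [Hr [_ Hin]]].
    apply (cdiff_local f _ _ r Hr); [|now apply Hd]. intros v Hv. rewrite clamp_id; [reflexivity|].
    apply Hin in Hv. unfold inobox, inbox in *. lra.
Qed.

Lemma Disk_box (z r : R) (w : C) : Disk (Defs.RtoC z) r w -> inobox (z - r) (z + r) (- r) r w.
Proof.
  unfold Disk. rewrite Cnorm_Cmod. intros H.
  pose proof (fst_le_Cmod (Csub w (Defs.RtoC z))) as F. pose proof (snd_le_Cmod (Csub w (Defs.RtoC z))) as G.
  unfold Csub, Defs.RtoC in *; simpl in F, G.
  pose proof (Rle_lt_trans _ _ _ F H) as F'. pose proof (Rle_lt_trans _ _ _ G H) as G'.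
  apply Rabs_lt_between in F', G'. unfold inobox. lra.
Qed.

(** With [r / 3] even the sum of the two coordinate distances, at most [2 r / 3], stays below
    [r]. *)
Lemma box_Disk (z r : R) (w : C) : 0 < r ->
  inbox (z - r / 3) (z + r / 3) (- (r / 3)) (r / 3) w -> Disk (Defs.RtoC z) r w.
Proof.
  unfold Disk. rewrite Cnorm_Cmod. intros Hr [H1 H2].
  eapply Rle_lt_trans; [apply Cmod_le_sum|]. unfold Csub, Defs.RtoC; simpl.
  assert (Rabs (fst w - z) <= r / 3) by (apply Rabs_le; lra).
  assert (Rabs (snd w - 0) <= r / 3) by (apply Rabs_le; lra). lra.
Qed.

Definition upper_ext (z r : R) (u : R -> C) : Prop := exists lam : C -> C,
  Defs.continuous_on (fun w => real_axis w \/ Omega z r w) lam /\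
  holomorphic_on (Omega z r) lam /\ (forall x : R, Rabs (x - z) < r -> lam (Defs.RtoC x) = u x).

(** Each point of the closed box lies on the axis or in the half disk, so the given function is
    continuous relative to the box, which is what [clamp_holo] asks for. *)
Lemma upper_ext_box (z r : R) (u : R -> C) : 0 < r -> upper_ext z r u -> box_ext false z (r / 3) u.
Proof.
  intros Hr [f [Cf [Df Ef]]]. unfold box_ext, lo.
  assert (In : forall w, inbox (z - r / 3) (z + r / 3) 0 (r / 3) w -> real_axis w \/ Omega z r w).
  { intros w Hw. destruct (Req_dec (snd w) 0) as [E|E]; [now left|]. right. split.
    - apply box_Disk; [assumption|]. unfold inbox in *. lra.
    - unfold Cim, inbox in *. lra. }
  exists (fun w => f (clamp (z - r / 3) (z + r / 3) 0 (r / 3) w)). split.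
  - apply clamp_holo; try lra.
    + intros p Hp e He. destruct (Cf p (In p Hp) e He) as [d [Hd H]]. exists d. split; [exact Hd|].
      intros w Hw Hwp. specialize (H w (In w Hw)). rewrite !Cnorm_Cmod in H. auto.
    + intros w Hw. apply Cdiff_at_iff, Df. destruct (In w) as [R|O]; [unfold inobox, inbox in *; lra | | exact O].
      unfold inobox in Hw. unfold real_axis, Cim in R. lra.
  - intros x Hx. rewrite clamp_id.
    + apply Ef. lra.
    + apply Rabs_le_between in Hx. unfold inbox; simpl. lra.
Qed.

Lemma box_upper_ext (z r : R) (u : R -> C) : box_ext false z r u -> upper_ext z r u.
Proof.
  intros [f [[Cf Df] Ef]]. exists f. split; [|split].
  - intros w _ e He. destruct (Cf w e He) as [d [Hd H]]. exists d. split; [exact Hd|].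
    intros v _. rewrite !Cnorm_Cmod. apply H.
  - intros w [Hw Pw]. apply Cdiff_at_iff, Df. apply Disk_box in Hw.
    unfold inobox, lo, Cim in *. lra.
  - intros x Hx. apply Ef. lra.
Qed.

Definition lower_ext (z r : R) (u : R -> C) : Prop := exists lam : C -> C,
  Defs.continuous_on (fun w => real_axis w \/ Pdisk z r w) lam /\
  holomorphic_on (Pdisk z r) lam /\ (forall x : R, Rabs (x - z) < r -> lam (Defs.RtoC x) = u x).

Lemma Disk_conj (z r : R) (w : C) : Disk (Defs.RtoC z) r w -> Disk (Defs.RtoC z) r (Cconj w).
Proof.
  unfold Disk. rewrite !Cnorm_Cmod. intros H.
  replace (Csub (Cconj w) (Defs.RtoC z)) with (Cconj (Csub w (Defs.RtoC z)));
    [now rewrite Cmod_conj|].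
  unfold Cconj, Csub, Defs.RtoC; simpl. f_equal. ring.
Qed.

Lemma conj_continuous_on (S T : C -> Prop) (f : C -> C) : (forall w, T w -> S (Cconj w)) ->
  Defs.continuous_on S f -> Defs.continuous_on T (fun w => Cconj (f (Cconj w))).
Proof.
  intros ST Cf w Tw e He. destruct (Cf (Cconj w) (ST w Tw) e He) as [d [Hd H]].
  exists d. split; [exact Hd|]. intros v Tv Hv. specialize (H (Cconj v) (ST v Tv)).
  rewrite !Cnorm_Cmod in *.
  change (Csub (Cconj (f (Cconj v))) (Cconj (f (Cconj w)))) with (Cconj (f (Cconj v)) - Cconj (f (Cconj w)))%C.
  rewrite <- Cminus_conj, Cmod_conj. apply H.
  change (Cmod (Cconj v - Cconj w) < d). now rewrite <- Cminus_conj, Cmod_conj.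
Qed.

Lemma conj_holomorphic_on (S T : C -> Prop) (f : C -> C) : (forall w, T w -> S (Cconj w)) ->
  holomorphic_on S f -> holomorphic_on T (fun w => Cconj (f (Cconj w))).
Proof.
  intros ST Df w Tw. apply Cdiff_at_iff, cdiff_conj, Cdiff_at_iff, Df. auto.
Qed.

(** If [f] extends [u] below, then [Cconj (f (Cconj w))] extends the conjugate of [u] above. Lower
    problems thus reduce to upper ones for another boundary function. *)
Lemma lower_ext_conj (z r : R) (u : R -> C) :
  lower_ext z r u <-> upper_ext z r (fun x => Cconj (u x)).
Proof.
  assert (PO : forall w, Omega z r w -> Pdisk z r (Cconj w)).
  { intros w [D I]. split; [now apply Disk_conj|]. unfold Cim in *; simpl. lra. }
  assert (OP : forall w, Pdisk z r w -> Omega z r (Cconj w)).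
  { intros w [D I]. split; [now apply Disk_conj|]. unfold Cim in *; simpl. lra. }
  assert (RR : forall w, real_axis w -> real_axis (Cconj w)).
  { unfold real_axis, Cim; simpl. intros w ->. ring. }
  assert (Rc : forall x, Cconj (Defs.RtoC x) = Defs.RtoC x).
  { intros x. unfold Cconj, Defs.RtoC; simpl. f_equal. ring. }
  split; intros [f [Cf [Df Ef]]]; exists (fun w => Cconj (f (Cconj w))); (split; [|split]).
  - revert Cf. apply conj_continuous_on. intros w [H|H]; auto.
  - revert Df. now apply conj_holomorphic_on.
  - intros x Hx. now rewrite Rc, Ef.
  - revert Cf. apply conj_continuous_on. intros w [H|H]; auto.
  - revert Df. now apply conj_holomorphic_on.
  - intros x Hx. now rewrite Rc, Ef, Cconj_conj.
Qed.

Definition no_box_ext (full : bool) (u : R -> C) : Prop :=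
  forall z r, 0 < r -> ~ box_ext full z r u.

Lemma U2_iff (k : natinf) (u : R -> C) : U2 k u <-> Ck k u /\ no_box_ext false u.
Proof.
  unfold U2. split; intros [HC H]; (split; [exact HC|]).
  - intros z r Hr E. apply box_upper_ext in E. destruct E as [f E]. apply H. exists z, r, f. tauto.
  - intros [z [r [f [Hr E]]]]. apply (H z (r / 3)); [lra|]. apply upper_ext_box; [exact Hr | now exists f].
Qed.

Lemma U3_iff (k : natinf) (u : R -> C) :
  U3 k u <-> Ck k u /\ no_box_ext false (fun x => Cconj (u x)).
Proof.
  unfold U3. split; intros [HC H]; (split; [exact HC|]).
  - intros z r Hr E. apply box_upper_ext, lower_ext_conj in E. destruct E as [f E]. apply H. exists z, r, f. tauto.
  - intros [z [r [f [Hr E]]]]. apply (H z (r / 3)); [lra|]. apply upper_ext_box; [exact Hr|].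
    apply lower_ext_conj. now exists f.
Qed.

Lemma U5_iff (k : natinf) (u : R -> C) : U5 k u <-> Ck k u /\ no_box_ext true u.
Proof.
  unfold U5. split; intros [HC H]; (split; [exact HC|]).
  - intros z r Hr [f [[Cf Df] Ef]]. apply H. exists z, r, f. split; [exact Hr|]. split.
    + intros w Hw. apply Cdiff_at_iff, Df. now apply Disk_box.
    + intros x Hx. apply Ef. lra.
  - intros [z [r [f [Hr [Df Ef]]]]]. apply (H z (r / 3)); [lra|]. unfold box_ext, lo.
    assert (D : forall w, inbox (z - r / 3) (z + r / 3) (- (r / 3)) (r / 3) w -> cdiff f w).
    { intros w Hw. apply Cdiff_at_iff, Df, box_Disk; assumption. }
    exists (fun w => f (clamp (z - r / 3) (z + r / 3) (- (r / 3)) (r / 3) w)). split.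
    + apply clamp_holo; try lra.
      * intros p Hp e He. destruct (cdiff_cont _ _ (D p Hp) e He) as [d [Hd H']]. exists d. auto.
      * intros w Hw. apply D. unfold inobox, inbox in *. lra.
    + intros x Hx. rewrite clamp_id.
      * apply Ef. lra.
      * apply Rabs_le_between in Hx. unfold inbox; simpl. lra.
Qed.

(** * Reduction to countably many boxes and the G-delta property *)

Definition grid_center (a b c : nat) : R := (INR a - INR b) / (INR c + 1).
Definition grid_radius (c : nat) : R := / (INR c + 1).

Lemma grid_radius_pos (c : nat) : 0 < grid_radius c.
Proof. apply Rinv_0_lt_compat. pose proof (pos_INR c). lra. Qed.

(** Center and radius share the denominator [c + 1]: rounding [z] costs at most one [grid_radius c],
    which is itself below [r / 2]. *)
Lemma grid_dense (z r : R) : 0 < r -> exists a b c,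
  Rabs (grid_center a b c - z) + grid_radius c <= r.
Proof.
  intros Hr. destruct (archimed_cor1 (r / 2) ltac:(lra)) as [c [Hc Hc0]].
  pose proof (pos_INR c) as Pc. set (t := z * (INR c + 1)). destruct (archimed t) as [A1 A2].
  (* [Z.to_nat] sends negative integers to 0, so the difference of the two is the integer [up t]. *)
  exists (Z.to_nat (up t)), (Z.to_nat (- up t)), c.
  assert (E : INR (Z.to_nat (up t)) - INR (Z.to_nat (- up t)) = IZR (up t)).
  { rewrite !INR_IZR_INZ, <- minus_IZR. f_equal. lia. }
  assert (G : grid_radius c < r / 2).
  { apply Rle_lt_trans with (/ INR c); [|assumption]. apply Rinv_le_contravar; [now apply lt_0_INR | lra]. }
  pose proof (grid_radius_pos c). unfold grid_center. rewrite E.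
  replace (IZR (up t) / (INR c + 1) - z) with ((IZR (up t) - t) * grid_radius c)
    by (unfold t, grid_radius; field; lra).
  rewrite Rabs_mult, (Rabs_pos_eq (grid_radius c)), Rabs_pos_eq by lra. nra.
Qed.

Lemma box_ext_sub (full : bool) (z r z' r' : R) (u : R -> C) : 0 < r' ->
  Rabs (z' - z) + r' <= r -> box_ext full z r u -> box_ext full z' r' u.
Proof.
  intros Hr' H [f [Hf Ef]]. pose proof (Rle_abs (z' - z)). pose proof (Rle_abs (- (z' - z))) as A.
  rewrite Rabs_Ropp in A. pose proof (Rabs_pos (z' - z)). exists f. split.
  - revert Hf. apply holo_sub; unfold lo; try destruct full; lra.
  - intros x Hx. apply Ef. replace (x - z) with ((x - z') + (z' - z)) by ring.
    eapply Rle_trans; [apply Rabs_triang | lra].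
Qed.

Lemma Ck_seq_0 (k : natinf) (u : R -> C) (du : nat -> R -> C) : is_Ck_seq k u du -> du 0%nat = u.
Proof. now intros [H _]. Qed.

(** If [u] cannot be approximated within [e], no [v] within [e / 2] of [u] on the interval can be
    approximated within [e / 2]. [N] is taken so large that the seminorms see the whole interval. *)
Lemma not_approx_open (k : natinf) (full : bool) (z r M : R) (s : C -> C) : 0 < r ->
  (forall v w, Cmod (s v - s w) = Cmod (v - w)) ->
  IsOpen k (fun u => ~ box_approx full z r M (fun x => s (u x))).
Proof.
  intros Hr Hs u du Hu Nu. apply not_all_ex_not in Nu. destruct Nu as [e Ne].
  apply imply_to_and in Ne. destruct Ne as [He Ne].
  destruct (INR_unbounded (Rabs z + r)) as [N HN]. exists N, (e / 2). split; [lra|].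
  intros v dv Hv Hclose Av. apply Ne. destruct (Av (e / 2) ltac:(lra)) as [f [Hf [Mf Ef]]].
  exists f. split; [exact Hf|]. split; [exact Mf|]. intros x Hx.
  specialize (Hclose 0%nat x (Nat.le_0_l N)).
  rewrite (Ck_seq_0 _ _ _ Hu), (Ck_seq_0 _ _ _ Hv), Cnorm_Cmod in Hclose.
  change (Csub (v x) (u x)) with (v x - u x)%C in Hclose. rewrite <- Hs in Hclose.
  assert (Cmod (s (v x) - s (u x)) < e / 2).
  { apply Hclose; [destruct k; simpl; [lia | trivial]|].
    replace x with ((x - z) + z) by ring. eapply Rle_trans; [apply Rabs_triang | lra]. }
  specialize (Ef x Hx). pose proof (Cmod_triangle_minus (f (x, 0)) (s (v x)) (s (u x))). lra.
Qed.

(** [s] is the identity or conjugation; as an isometry it preserves approximation errors. A function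
    without extensions escapes every approximation set by [box_approx_ext]. Conversely an extension,
    restricted to a closed grid box, is bounded by some [INR m + 1] and serves as its own
    approximant. *)
Lemma no_box_ext_Gdelta (k : natinf) (full : bool) (s : C -> C) (A : (R -> C) -> Prop) :
  (forall v w, Cmod (s v - s w) = Cmod (v - w)) ->
  (forall u, A u <-> Ck k u /\ no_box_ext full (fun x => s (u x))) -> Gdelta k A.
Proof.
  intros Hs HA.
  exists (fun j => let (a, j) := Cantor.of_nat j in let (b, j) := Cantor.of_nat j in
    let (c, m) := Cantor.of_nat j in
    fun u => ~ box_approx full (grid_center a b c) (grid_radius c) (INR m + 1) (fun x => s (u x))).
  split.
  - intros j. destruct (Cantor.of_nat j) as [a j1], (Cantor.of_nat j1) as [b j2], (Cantor.of_nat j2) as [c m].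
    apply not_approx_open; [apply grid_radius_pos | exact Hs].
  - intros u HC. rewrite HA. split.
    + intros [_ H] j.
      destruct (Cantor.of_nat j) as [a j1], (Cantor.of_nat j1) as [b j2], (Cantor.of_nat j2) as [c m].
      intros App. pose proof (grid_radius_pos c). pose proof (pos_INR m).
      apply box_approx_ext in App; [|lra|lra]. apply H in App; [exact App | lra].
    + intros H. split; [exact HC|]. intros z r Hr E.
      destruct (grid_dense z r Hr) as [a [b [c G]]]. pose proof (grid_radius_pos c) as Pc.
      apply (box_ext_sub _ _ _ _ _ _ Pc G) in E. destruct E as [f [Hf Ef]].
      destruct (box_bounded f (grid_center a b c - grid_radius c) (grid_center a b c + grid_radius c)
        (lo full (grid_radius c)) (grid_radius c)) as [M [_ HM]]; [lra | unfold lo; destruct full; lra | apply Hf |].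
      destruct (INR_unbounded M) as [m Hm].
      specialize (H (Cantor.to_nat (a, Cantor.to_nat (b, Cantor.to_nat (c, m))))).
      rewrite !Cantor.cancel_of_to in H. apply H. intros e He. exists f. split; [exact Hf|]. split.
      * intros w Hw. specialize (HM w Hw). lra.
      * intros x Hx. rewrite Ef, Cmod_diag by exact Hx. lra.
Qed.

Lemma Gdelta_and (k : natinf) (A B : (R -> C) -> Prop) :
  Gdelta k A -> Gdelta k B -> Gdelta k (fun u => A u /\ B u).
Proof.
  intros [O [HO EA]] [P [HP EB]].
  exists (fun n => let (i, j) := Cantor.of_nat n in fun u => O i u /\ P j u). split.
  - intros n. destruct (Cantor.of_nat n) as [i j]. intros u du Hu [Ou Pu].
    destruct (HO i u du Hu Ou) as [N1 [e1 [He1 H1]]]. destruct (HP j u du Hu Pu) as [N2 [e2 [He2 H2]]].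
    exists (Nat.max N1 N2), (Rmin e1 e2). split; [now apply Rmin_glb_lt|]. intros v dv Hv Hcl.
    pose proof (Rmin_l e1 e2). pose proof (Rmin_r e1 e2).
    pose proof (le_INR _ _ (Nat.le_max_l N1 N2)). pose proof (le_INR _ _ (Nat.le_max_r N1 N2)).
    split; [apply (H1 v dv Hv) | apply (H2 v dv Hv)]; intros l x Hl Hk Hx;
      (eapply Rlt_le_trans; [apply (Hcl l x); [lia | exact Hk | lra] | assumption]).
  - intros u HC. rewrite (EA u HC), (EB u HC). split.
    + intros [Ou Pu] n. destruct (Cantor.of_nat n) as [i j]. auto.
    + intros H. split; intros n; [specialize (H (Cantor.to_nat (n, 0%nat))) | specialize (H (Cantor.to_nat (0%nat, n)))];
        rewrite Cantor.cancel_of_to in H; apply H.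
Qed.

(** * Density *)

Lemma avoid_countable (Bad : nat -> R -> Prop) (d : R) : 0 < d ->
  (forall j s t, Bad j s -> Bad j t -> s = t) -> exists t, 0 < t < d /\ forall j, ~ Bad j t.
Proof.
  intros Hd Uniq.
  set (L := fun n => d / 3 / 3 ^ n).
  assert (LS : forall n, L n = 3 * L (S n)).
  { intros n. unfold L. simpl. field. apply pow_nonzero. lra. }
  assert (PL : forall n, 0 < L n).
  { intros n. unfold L. apply Rdiv_lt_0_compat; [lra|]. apply pow_lt. lra. }
  (* Cantor's diagonal argument with thirds, started from [[d/3, 2d/3]] to stay inside [(0, d)]: if
     the left third holds a bad parameter of index [n], the right third is kept and is disjoint from
     it; otherwise the left third itself is safe. *)
  set (x := fix x n := match n with O => d / 3 | S n =>
    if excluded_middle_informative (exists t, Bad n t /\ x n <= t <= x n + L (S n))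
    then x n + 2 * L (S n) else x n end).
  destruct (nested_limit x L) as [p Hp].
  - intros n. left. apply PL.
  - intros n. simpl. pose proof (LS n). pose proof (PL (S n)). destruct excluded_middle_informative; lra.
  - exists p. split.
    + specialize (Hp 0%nat). simpl in Hp. unfold L in Hp. simpl in Hp. rewrite Rdiv_1_r in Hp. lra.
    + intros j Bj. pose proof (Hp (S j)) as Q. simpl in Q. pose proof (PL (S j)).
      destruct excluded_middle_informative as [[t [Bt Ht]]|n].
      * rewrite (Uniq j p t Bj Bt) in Q. lra.
      * apply n. exists p. split; [exact Bj | exact Q].
Qed.

Lemma box_ext_unique_multiple (z r s t : R) (u : R -> C) : 0 < r ->
  box_ext false z r (fun x => u x + RtoC (s * lac 0 x))%C ->
  box_ext false z r (fun x => u x + RtoC (t * lac 0 x))%C -> s = t.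
Proof.
  intros Hr [f [Hf Ef]] [g [Hg Eg]]. apply NNPP. intros n.
  assert (n' : s - t <> 0) by lra.
  apply (lac_not_ext z r Hr). exists (fun w => RtoC (/ (s - t)) * (f w - g w))%C. split.
  - apply holo_mult; [apply entire_holo; intros; apply cdiff_const | now apply holo_minus].
  - intros x Hx. rewrite Ef, Eg by exact Hx.
    replace (u x + RtoC (s * lac 0 x) - (u x + RtoC (t * lac 0 x)))%C with (RtoC ((s - t) * lac 0 x)).
    + rewrite <- RtoC_mult. f_equal. field. exact n'.
    + rewrite !RtoC_mult, RtoC_minus. ring.
Qed.

Theorem U4_Dense (k : natinf) : Dense k (U4 k).
Proof.
  intros u du Hu N e He.
  pose proof (lac_sup_nonneg N) as PN.
  set (v := fun t x => (u x + RtoC (t * lac 0 x))%C).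
  (* The index [i] selects the side: 0 for upper extensions of [u + t W], any other value for those
     of its conjugate, which is the conjugate of [u] plus the same [t W]. *)
  set (Bad := fun j => let (a, j) := Cantor.of_nat j in let (b, j) := Cantor.of_nat j in
    let (c, i) := Cantor.of_nat j in
    fun t => box_ext false (grid_center a b c) (grid_radius c)
      (fun x => match i with O => u x | S _ => Cconj (u x) end + RtoC (t * lac 0 x))%C).
  (* By monotonicity [lac_sup N] bounds the derivatives of all orders up to [N]; adding 1 keeps the
     quotient meaningful if it is 0. *)
  destruct (avoid_countable Bad (e / (lac_sup N + 1))) as [t [Ht HB]].
  - apply Rdiv_lt_0_compat; lra.
  - intros j s t. unfold Bad.
    destruct (Cantor.of_nat j) as [a j1], (Cantor.of_nat j1) as [b j2], (Cantor.of_nat j2) as [c i].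
    apply box_ext_unique_multiple, grid_radius_pos.
  - set (dv := fun l x => (du l x + RtoC (t * lac l x))%C).
    assert (Hv : is_Ck_seq k (v t) dv).
    { destruct Hu as [H0 [H1 H2]]. split; [|split].
      - unfold dv, v. now rewrite H0.
      - intros l Hl x. destruct (H1 l Hl x) as [D1 D2]. unfold dv; simpl. split.
        + apply (derivable_pt_lim_plus (fun x => fst (du l x)) (fun x => t * lac l x)); [exact D1|].
          apply (derivable_pt_lim_scal (lac l)), lac_derive.
        + apply (derivable_pt_lim_plus (fun x => snd (du l x)) (fun _ => 0)); [exact D2|].
          apply derivable_pt_lim_const.
      - intros l Hl. destruct (H2 l Hl) as [C1 C2]. unfold dv; simpl. split.
        + apply (continuity_plus (fun x => fst (du l x)) (fun x => t * lac l x)); [exact C1|].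
          apply (continuity_scal (lac l)), lac_continuous.
        + apply (continuity_plus (fun x => snd (du l x)) (fun _ => 0)); [exact C2|].
          now apply continuity_const. }
    assert (NE : forall i : nat, no_box_ext false
      (fun x => match i with O => u x | S _ => Cconj (u x) end + RtoC (t * lac 0 x))%C).
    { intros i z r Hr E. destruct (grid_dense z r Hr) as [a [b [c G]]].
      apply (box_ext_sub _ _ _ _ _ _ (grid_radius_pos c) G) in E.
      apply (HB (Cantor.to_nat (a, Cantor.to_nat (b, Cantor.to_nat (c, i))))).
      unfold Bad. now rewrite !Cantor.cancel_of_to. }
    exists (v t), dv. split; [exact Hv|]. split.
    + split.
      * apply U2_iff. split; [now exists dv | apply (NE 0%nat)].
      * apply U3_iff. split; [now exists dv|]. intros z r Hr [f [Hf Ef]]. apply (NE 1%nat z r Hr).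
        exists f. split; [exact Hf|]. intros x Hx. rewrite Ef by exact Hx.
        unfold v. rewrite Cplus_conj. f_equal. unfold Cconj, RtoC; simpl. f_equal. ring.
    + intros l x Hl _ _. rewrite Cnorm_Cmod.
      replace (Csub (dv l x) (du l x)) with (RtoC (t * lac l x)).
      * rewrite Cmod_R, Rabs_mult, (Rabs_pos_eq t) by lra.
        apply Rle_lt_trans with (t * (lac_sup N + 1)).
        -- apply Rmult_le_compat_l; [lra|]. pose proof (lac_bound l x). pose proof (lac_sup_mono l N Hl). lra.
        -- apply Rlt_le_trans with (e / (lac_sup N + 1) * (lac_sup N + 1)); [apply Rmult_lt_compat_r; lra|].
           right. field. lra.
      * rewrite Csub_Cminus. unfold dv. ring.
Qed.

Lemma Dense_mono (k : natinf) (A B : (R -> C) -> Prop) :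
  (forall u, A u -> B u) -> Dense k A -> Dense k B.
Proof.
  intros H HA u du Hu N e He. destruct (HA u du Hu N e He) as [v [dv [Hv [Av Hc]]]].
  exists v, dv. auto.
Qed.

(** A two-sided extension restricts to the upper half box. *)
Lemma U4_U5 (k : natinf) (u : R -> C) : U4 k u -> U5 k u.
Proof.
  intros [H _]. apply U2_iff in H. destruct H as [HC H]. apply U5_iff. split; [exact HC|].
  intros z r Hr [f [Hf Ef]]. apply (H z r Hr). exists f. split; [|exact Ef].
  revert Hf. apply holo_sub; unfold lo; lra.
Qed.

Theorem theorem4p20 (k : natinf) :
  (Dense k (U2 k) /\ Gdelta k (U2 k)) /\
  (Dense k (U3 k) /\ Gdelta k (U3 k)) /\
  (Dense k (U4 k) /\ Gdelta k (U4 k)) /\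
  (Dense k (U5 k) /\ Gdelta k (U5 k)).
Proof.
  pose proof (U4_Dense k) as D.
  assert (G2 : Gdelta k (U2 k)).
  { apply (no_box_ext_Gdelta k false (fun w => w)); [reflexivity | apply U2_iff]. }
  assert (G3 : Gdelta k (U3 k)).
  { apply (no_box_ext_Gdelta k false Cconj); [|apply U3_iff].
    intros v w. now rewrite <- Cminus_conj, Cmod_conj. }
  repeat split; try assumption.
  - revert D. apply Dense_mono. now intros u [H _].
  - revert D. apply Dense_mono. now intros u [_ H].
  - now apply Gdelta_and.
  - revert D. apply Dense_mono, U4_U5.
  - apply (no_box_ext_Gdelta k true (fun w => w)); [reflexivity | apply U5_iff].
Qed.
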